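(* Let $S$ be an isotropic spray, with Jacobi endomorphism $\Phi(Y)=\lambda Y+c(Y)\mathbf T$ for all vector fields $Y$ along $\tau$, where $c$ is a one-form along $\tau$ and $\lambda$ is nowhere zero. Consider a projective change $\tilde S=S-2P\Delta$, with $a=P^2-S(P)$, such that $\lambda+a$ is nowhere zero. Then the bracket property $[\tilde\nabla\tilde\Phi,\tilde\Phi]=0$ holds true for $\tilde S$ if, for all $X\in D_\lambda$, $$\big(\nabla(c+b)\big)(X)+\left(P-\frac{S(\lambda+a)}{\lambda+a}\right)b(X)+(\lambda+a)\,(d^VP)(X)=0 .$$
   Context: $M$ is a smooth manifold, $\tau:TM\to M$, natural coordinates $(x^i,\dot x^i)$. All objects are smooth on the slit tangent bundle $T^\circ M$. A vector field along $\tau$ is $X=X^i(x,\dot x)\frac{\partial}{\partial x^i}$; $\mathbf T=\dot x^i\frac{\partial}{\partial x^i}$. A spray is a vector field $S=\dot x^i\frac{\partial}{\partial x^i}+f^i(x,\dot x)\frac{\partial}{\partial\dot x^i}$ with $[\Delta,S]=S$, where $\Delta=\dot x^i\frac{\partial}{\partial\dot x^i}$ (so $f^i$ is positively 2-homogeneous in $\dot x$). Put $\Gamma^i_j=-\frac12\frac{\partial f^i}{\partial\dot x^j}$. Vertical and horizontal lifts: $X^V=X^i\frac{\partial}{\partial\dot x^i}$, $X^H=X^i\big(\frac{\partial}{\partial x^i}-\Gamma^j_i\frac{\partial}{\partial\dot x^j}\big)$. The dynamical covariant derivative is $\nabla X=\big(S(X^i)+\Gamma^i_jX^j\big)\frac{\partial}{\partial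 x^i}$ on vector fields along $\tau$, $\nabla F=S(F)$ on functions, $(\nabla\beta)(X)=S(\beta(X))-\beta(\nabla X)$ on one-forms along $\tau$, and $(\nabla\Phi)(X)=\nabla(\Phi(X))-\Phi(\nabla X)$ on type (1,1) tensor fields along $\tau$. The Jacobi endomorphism $\Phi$ is the (1,1) tensor field along $\tau$ with components $\Phi^i_j=-\frac{\partial f^i}{\partial x^j}-\Gamma^k_j\Gamma^i_k-S(\Gamma^i_j)$. For a spray, $\nabla\mathbf T=0$ and $\Phi(\mathbf T)=0$. $D_\lambda$ denotes the eigendistribution of $\Phi$ for the eigenfunction $\lambda$ (the vector fields $X$ along $\tau$ with $\Phi(X)=\lambda X$). A spray is isotropic if $\Phi(Y)=\lambda Y+c(Y)\mathbf T$ for all $Y$, for some function $\lambda$ and one-form $c$ along $\tau$. A projective change of $S$ is $\tilde S=S-2P\Delta$ with $P$ positively 1-homogeneous ($P(\mu v)=\mu P(v)$ for $\mu>0$). $\tilde\nabla,\tilde\Phi$ are the objects above for $\tilde S$. One has $\tilde\Phi(X)=\Phi(X)+aX+b(X)\mathbf T$ with $a=P^2-S(P)$ and the one-form $b$ along $\tau$ given by $b(X)=3X^H(P)-P\,X^V(P)-X^V(S(P))$. The one-form $d^VP$ is $(d^VP)(X)=X^V(P)$. The bracket $[\nabla\Phi,\Phi]$ is the commutator of endomorphisms $\nabla\Phi\circ\Phi-\Phi\circ\nabla\Phi$. *)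

(* Defs.v *)
From HB Require Import structures.
From mathcomp Require Import all_boot all_order all_algebra.
From mathcomp Require Import all_classical all_reals all_analysis.

Set Implicit Arguments.
Unset Strict Implicit.
Unset Printing Implicit Defensive.

Import Order.TTheory GRing.Theory Num.Theory.
Import numFieldNormedType.Exports.

Local Open Scope classical_set_scope.
Local Open Scope ring_scope.

(* [Ck k U f]: [f] is of class C^k on the open set [U] of a finite-dimensional
   space, by recursion on directional derivatives. *)
Fixpoint Ck (R : realType) (V W : normedModType R) (k : nat) (U : set V)
    (f : V -> W) : Prop :=
  match k with
  | 0%N => forall x, U x -> {for x, continuous f}
  | k'.+1 => (forall x, U x -> differentiable f x) /\
             (forall v : V, Ck k' U ('D_v f))
  end.

Definition smooth_on (R : realType) (V W : normedModType R) (U : set V)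
    (f : V -> W) : Prop := forall k, Ck k U f.

(* The smooth structure is given by an atlas, which need not be maximal.
   [chart_map a] is only meaningful on [chart_dom a], and [chart_inv a] only on
   its image. *)
Record smooth_manifold (R : realType) (n : nat) := SmoothManifold {
  carrier :> topologicalType;
  chart : Type;
  chart_dom : chart -> set carrier;
  chart_map : chart -> carrier -> 'rV[R]_n;
  chart_inv : chart -> 'rV[R]_n -> carrier;
  _ : hausdorff_space carrier;
  _ : @second_countable carrier;
  _ : forall m : carrier, exists a, chart_dom a m;
  _ : forall a, open (chart_dom a);
  _ : forall a, open (chart_map a @` chart_dom a);
  _ : forall a m, chart_dom a m -> chart_inv a (chart_map a m) = m;
  _ : forall a, {within chart_dom a, continuous (chart_map a)};
  _ : forall a,
      {within chart_map a @` chart_dom a, continuous (chart_inv a)};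
  _ : forall a b,
      smooth_on (chart_map a @` (chart_dom a `&` chart_dom b))
                (chart_map b \o chart_inv a)
}.

Section SlitTangentBundle.
Context (R : realType) (n : nat) (M : smooth_manifold R n).

(* Natural coordinates (x, xdot). *)
Definition tcoord := ('rV[R]_n * 'rV[R]_n)%type.

Definition chart_trans (a b : chart M) : 'rV[R]_n -> 'rV[R]_n :=
  chart_map b \o chart_inv a.

Definition tchart_trans (a b : chart M) (p : tcoord) : tcoord :=
  (chart_trans a b p.1, 'D_(p.2) (chart_trans a b) p.1).

(* The part of the slit tangent bundle lying over the chart [a], resp. over the
   intersection of the charts [a] and [b], in the natural coordinates of [a]. *)
Definition slit (a : chart M) : set tcoord :=
  [set p | (chart_map a @` chart_dom a) p.1 /\ p.2 != 0].

Definition slit_overlap (a b : chart M) : set tcoord :=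
  [set p | (chart_map a @` (chart_dom a `&` chart_dom b)) p.1 /\ p.2 != 0].

(* An object on the slit tangent bundle is given by its components in the
   natural coordinates of every chart (only the values on [slit a] matter):
   [func] for functions, [along] and [covec] for vector fields and one-forms
   along tau, [tfield] for vector fields on the slit tangent bundle itself. The
   predicates [is_func], [is_along], [is_covec], [is_tfield] express smoothness
   and the transformation law under changes of charts. *)
Definition func := chart M -> tcoord -> R.
Definition along := chart M -> tcoord -> 'rV[R]_n.
Definition covec := chart M -> tcoord -> 'rV[R]_n.
Definition tfield := chart M -> tcoord -> tcoord.

Definition is_func (F : func) : Prop :=
  (forall a, smooth_on (slit a) (F a)) /\
  (forall a b p, slit_overlap a b p -> F b (tchart_trans a b p) = F a p).

Definition is_along (X : along) : Prop :=
  (forall a, smooth_on (slit a) (X a)) /\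
  (forall a b p, slit_overlap a b p ->
     X b (tchart_trans a b p) = 'D_(X a p) (chart_trans a b) p.1).

Definition is_covec (c : covec) : Prop :=
  (forall a, smooth_on (slit a) (c a)) /\
  (forall a b p, slit_overlap a b p -> forall u : 'rV[R]_n,
     \sum_(k < n)
        c b (tchart_trans a b p) 0 k * ('D_u (chart_trans a b) p.1) 0 k
     = \sum_(k < n) c a p 0 k * u 0 k).

Definition is_tfield (V : tfield) : Prop :=
  (forall a, smooth_on (slit a) (V a)) /\
  (forall a b p, slit_overlap a b p ->
     V b (tchart_trans a b p) = 'D_(V a p) (tchart_trans a b) p).

Definition nowhere_zero (F : func) : Prop :=
  forall a p, slit a p -> F a p != 0.

Definition homogeneous1 (P : func) : Prop :=
  forall a p (mu : R), slit a p -> 0 < mu ->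
    P a (p.1, mu *: p.2) = mu * P a p.

Definition func_add (F G : func) : func := fun a p => F a p + G a p.

Definition lie_der (V : tfield) (F : func) : func :=
  fun a p => 'D_(V a p) (F a) p.

Definition lie_bracket (V W : tfield) : tfield :=
  fun a p => 'D_(V a p) (W a) p - 'D_(W a p) (V a) p.

Definition Tcan : along := fun _ p => p.2.

Definition Liouville : tfield := fun _ p => (0, p.2).

Definition is_spray (S : tfield) : Prop :=
  [/\ is_tfield S,
      forall a p, slit a p -> (S a p).1 = p.2
    & forall a p, slit a p -> lie_bracket Liouville S a p = S a p].

Definition proj_change (S : tfield) (P : func) : tfield :=
  fun a p => S a p - (2 * P a p) *: Liouville a p.

Definition dx (k : 'I_n) (F : func) : func :=
  fun a p => 'D_((delta_mx 0 k, 0) : tcoord) (F a) p.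

Definition dxdot (k : 'I_n) (F : func) : func :=
  fun a p => 'D_((0, delta_mx 0 k) : tcoord) (F a) p.

Definition component (X : along) (i : 'I_n) : func := fun a p => X a p 0 i.

Definition spray_coef (S : tfield) (i : 'I_n) : func :=
  fun a p => (S a p).2 0 i.

Definition Gam (S : tfield) (i j : 'I_n) : func :=
  fun a p => - 2^-1 * dxdot j (spray_coef S i) a p.

Definition vlift (X : along) : tfield := fun a p => (0, X a p).

Definition hlift (S : tfield) (X : along) : tfield :=
  fun a p => (X a p, - \row_j \sum_(i < n) Gam S j i a p * X a p 0 i).

Definition nabla (S : tfield) (X : along) : along :=
  fun a p => \row_i (lie_der S (component X i) a p
                     + \sum_(j < n) Gam S i j a p * X a p 0 j).

(* One-forms and (1,1) tensor fields along tau as operators on vector fields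
   along tau. *)
Definition form_op := along -> func.
Definition endo_op := along -> along.

Definition pairing (c : covec) : form_op :=
  fun X a p => \sum_(k < n) c a p 0 k * X a p 0 k.

Definition add_form (beta gamma : form_op) : form_op :=
  fun X => func_add (beta X) (gamma X).

Definition nabla_form (S : tfield) (beta : form_op) : form_op :=
  fun X a p => lie_der S (beta X) a p - beta (nabla S X) a p.

Definition nabla_endo (S : tfield) (Phi : endo_op) : endo_op :=
  fun X a p => nabla S (Phi X) a p - Phi (nabla S X) a p.

Definition bracket (Phi Psi : endo_op) : endo_op :=
  fun X a p => Phi (Psi X) a p - Psi (Phi X) a p.

Definition Jacobi_comp (S : tfield) (i j : 'I_n) : func :=
  fun a p => - dx j (spray_coef S i) a p
             - \sum_(k < n) Gam S k j a p * Gam S i k a p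
             - lie_der S (Gam S i j) a p.

Definition Jacobi (S : tfield) : endo_op :=
  fun X a p => \row_i \sum_(j < n) Jacobi_comp S i j a p * X a p 0 j.

Definition eigenfield (Phi : endo_op) (lam : func) (X : along) : Prop :=
  is_along X /\ forall a p, slit a p -> Phi X a p = lam a p *: X a p.

Definition isotropic_with (S : tfield) (lam : func) (c : covec) : Prop :=
  forall Y, is_along Y -> forall a p, slit a p ->
    Jacobi S Y a p = lam a p *: Y a p + pairing c Y a p *: Tcan a p.

Definition dV (P : func) : form_op := fun X => lie_der (vlift X) P.

(* The coefficients of the change of the Jacobi endomorphism
   Phi~(X) = Phi(X) + a X + b(X) T under S~ = S - 2 P Delta. *)
Definition proj_a (S : tfield) (P : func) : func :=
  fun a p => P a p ^+ 2 - lie_der S P a p.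

Definition proj_b (S : tfield) (P : func) : form_op :=
  fun X a p => 3 * lie_der (hlift S X) P a p
               - P a p * lie_der (vlift X) P a p
               - lie_der (vlift X) (lie_der S P) a p.

End SlitTangentBundle.

(* Main.v *)
(* Isotropy reads Phi = lambda I + c (x) T, and Phi T = 0 forces c(T) = - lambda, so
   every field along tau is, up to a multiple of T, a section X of D_lambda = ker c.
   The projective change keeps this shape: Phi' = mu I + e (x) T with mu = lambda + a
   and e = c + b. The bracket [nabla' Phi', Phi'] is tensorial and kills T (because
   Phi' T = 0 and nabla' T = 0), and on X it equals
     (mu (nabla' e)(X) - S'(mu) e(X)) T.
   Writing S' = S - 2 P Delta and
     nabla' X = nabla X - 2 P Delta X + P X + X^V(P) T,
   and using that mu is 2-homogeneous and e is 1-homogeneous, the coefficient becomes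
   mu times the left-hand side of the hypothesis.

   The isotropy hypothesis is only available for global fields, so nabla X and the
   componentwise derivative Delta X are shown to be global fields. The homogeneity
   of mu and e is obtained by differentiating Phi' X = mu X + e(X) T along Delta; it
   needs X and T to be linearly independent at the point, and at the other points
   the bracket vanishes since it kills T. *)

From HB Require Import structures.
Require Import Defs.
From mathcomp Require Import all_boot all_order all_algebra.
From mathcomp Require Import all_classical all_reals all_analysis.
From mathcomp Require Import ring.
Import Order.TTheory GRing.Theory Num.Theory.
Import numFieldNormedType.Exports.
Local Open Scope classical_set_scope.
Local Open Scope ring_scope.

Set Implicit Arguments.
Unset Strict Implicit.
Unset Printing Implicit Defensive.

(** * Directional derivatives *)

Section DirectionalDerivatives.
Context {R : realType}.
Implicit Types V W E : normedModType R.

(** In a chart, a tensor at [p] is written as a function of a vector [u], with Gamma read off from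
    the derivative of [f] along [(0, u)]; indices occur only where the definitions are unfolded. The
    cost is that [nabla] and the Jacobi endomorphism differentiate along directions that move with
    the point. Everything rests on a Leibniz rule for such derivatives, which splits off a second
    derivative with the direction frozen, and on the symmetry of second derivatives. Homogeneity
    enters as Euler's relation along [(0, q.2)]. Chart components are total functions constrained on
    an open slit alone, so an identity there is differentiated through equality near a point. Each
    tensor identity then becomes a list of derivative identities followed by a linear identity in
    independent letters, the local facts [alg]. *)

Lemma near_differentiable V W (f g : V -> W) (x : V) :
  (\forall y \near x, f y = g y) -> differentiable f x -> differentiable g x.
Proof.
move=> fg df.
have gxE : g x = f x by rewrite -(nbhs_singleton fg).
have cd : continuous ('d f x) by exact: diff_continuous.
have e : g \o shift x = cst (g x) + 'd f x +o_ 0 id.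
  apply/eqaddoP => _/posnumP[e].
  have /eqaddoP/(_ e%:num (gt0 e)) h1 := diff_locally df.
  have h2 : \forall y \near (0 : V), f (y + x) = g (y + x).
    by move: fg; rewrite (near_shift 0) subr0.
  near=> y.
  have h3 : f (y + x) = g (y + x) by near: y.
  have : `|((f \o shift x) - (cst (f x) + 'd f x)) y| <= e%:num * `|y| by near: y.
  rewrite -![(_ - _ : _ -> _) _]/(_ - _) -![(_ + _ : _ -> _) _]/(_ + _) /=.
  by rewrite h3 gxE.
apply/diff_locallyP; rewrite (diff_unique cd e); split => //.
Unshelve. all: by end_near. Qed.

Lemma derive_addv V W (f : V -> W) p u v : differentiable f p ->
  'D_(u + v) f p = 'D_u f p + 'D_v f p.
Proof. by move=> df; rewrite !deriveE // linearD. Qed.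

Lemma derive_scalev V W (f : V -> W) p a u : differentiable f p ->
  'D_(a *: u) f p = a *: 'D_u f p.
Proof. by move=> df; rewrite !deriveE // linearZ. Qed.

Lemma derive_oppv V W (f : V -> W) p u : differentiable f p ->
  'D_(- u) f p = - 'D_u f p.
Proof. by move=> df; rewrite !deriveE // linearN. Qed.

Lemma derive_sumv V W (I : finType) (f : V -> W) p (u : I -> V) :
  differentiable f p -> 'D_(\sum_i u i) f p = \sum_i 'D_(u i) f p.
Proof.
by move=> df; rewrite deriveE // linear_sum; apply: eq_bigr => i _; rewrite deriveE.
Qed.

Lemma derive_comp V W E (f : V -> W) (g : W -> E) p v :
  differentiable f p -> differentiable g (f p) ->
  'D_v (g \o f) p = 'D_('D_v f p) g (f p).
Proof.
move=> df dg; rewrite (deriveE _ (differentiable_comp df dg)).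
by rewrite (deriveE _ df) (deriveE _ dg) (diff_comp df dg).
Qed.

Lemma derive_pair V W E (f : V -> W) (g : V -> E) p v :
  differentiable f p -> differentiable g p ->
  'D_v (fun x => (f x, g x)) p = ('D_v f p, 'D_v g p).
Proof.
move=> df dg; rewrite (deriveE _ (differentiable_pair df dg)).
by rewrite (diff_pair df dg) (deriveE _ df) (deriveE _ dg).
Qed.

Lemma scaler_is_bilinear W :
  bilinear_for (GRing.Scale.Law.clone _ _ *:%R _) (GRing.Scale.Law.clone _ _ *:%R _)
    (@GRing.scale R W : R -> W -> W).
Proof.
split=> [u'|u] a x y /=.
- by rewrite scalerDl scalerA.
- by rewrite scalerDr !scalerA mulrC.
Qed.

(** Seen as a bilinear map, scaling turns the product rule for a scalar function times a
    vector-valued one into an instance of the chain rule. *)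
Let scale_bilinear W : {bilinear R -> W -> W} :=
  HB.pack (@GRing.scale R W : R -> W -> W)
    (bilinear_isBilinear.Build R R W W _ _ _ (@scaler_is_bilinear W)).

Lemma differentiable_scale V W (k : V -> R) (f : V -> W) p :
  differentiable k p -> differentiable f p ->
  differentiable (fun x => k x *: f x) p.
Proof.
move=> dk df.
have cb : continuous (fun p => scale_bilinear W p.1 p.2).
  by move=> q; exact: scale_continuous.
exact: (differentiable_comp (differentiable_pair dk df)
          (differentiable_bilin (k p, f p) cb)).
Qed.

Lemma derive_scale V W (k : V -> R) (f : V -> W) p v :
  differentiable k p -> differentiable f p ->
  'D_v (fun x => k x *: f x) p = 'D_v k p *: f p + k p *: 'D_v f p.
Proof.
move=> dk df.
have cb : continuous (fun p => scale_bilinear W p.1 p.2).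
  by move=> q; exact: scale_continuous.
have db := differentiable_bilin (k p, f p) cb.
have dp := differentiable_pair dk df.
rewrite (derive_comp (f := fun x => (k x, f x)) v dp db) (derive_pair v dk df).
by rewrite (deriveE _ db) (diff_bilin _ cb) addrC.
Qed.

Lemma differentiable_bigsum V W (I : Type) (r : seq I) (F : I -> V -> W) p :
  (forall i, differentiable (F i) p) ->
  differentiable (fun x => \sum_(i <- r) F i x) p.
Proof.
move=> dF; elim: r => [|i r IH].
  rewrite (_ : (fun x => _) = cst 0); first exact: differentiable_cst.
  by apply/funext => x; rewrite big_nil.
rewrite (_ : (fun x => _) = F i + (fun x => \sum_(i <- r) F i x)).
  exact: differentiableD.
by apply/funext => x; rewrite big_cons.
Qed.

Lemma derive_bigsum V W (I : Type) (r : seq I) (F : I -> V -> W) p v :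
  (forall i, differentiable (F i) p) ->
  'D_v (fun x => \sum_(i <- r) F i x) p = \sum_(i <- r) 'D_v (F i) p.
Proof.
move=> dF; elim: r => [|i r IH].
  rewrite (_ : (fun x => _) = cst 0) ?derive_cst ?big_nil //.
  by apply/funext => x; rewrite big_nil.
rewrite big_cons -IH (_ : (fun x => _) = F i + (fun x => \sum_(i <- r) F i x)).
  by rewrite deriveD //; apply: diff_derivable => //; apply: differentiable_bigsum.
by apply/funext => x; rewrite big_cons.
Qed.

(** Restriction to a line makes the one-variable mean value theorem available for directional
    derivatives. *)
Lemma is_derive_line V W (f : V -> W) (q v : V) (t : R) :
  differentiable f (q + t *: v) ->
  is_derive t 1 (fun s : R => f (q + s *: v)) ('D_v f (q + t *: v)).
Proof.
move=> df; have [cf vf] := derivableP (@diff_derivable _ _ _ f _ v df).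
have e : (fun h : R => h^-1 *: (((fun s : R => f (q + s *: v)) \o shift t) (h *: 1)
            - f (q + t *: v)))
       = (fun h : R => h^-1 *: ((f \o shift (q + t *: v)) (h *: v) - f (q + t *: v))).
  apply/funext => h /=; congr (_ *: (f _ - _)).
  by rewrite [h *: 1]mulr1 scalerDl addrCA.
by apply: DeriveDef; rewrite /derivable /derive e.
Qed.

(** The mean value theorem is applied twice: along [v] to the difference of [f] on two parallel
    sides, then along [u] to ['D_v f]. Exchanging [u] and [v] gives the other mixed derivative. *)
Lemma second_difference V (f : V -> R) (p u v : V) (r : R) : 0 < r ->
  (forall s t, 0 <= s <= r -> 0 <= t <= r ->
    differentiable f (p + s *: u + t *: v) /\
    differentiable ('D_v f) (p + s *: u + t *: v)) ->
  exists s t, [/\ 0 <= s <= r, 0 <= t <= r &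
    f (p + r *: u + r *: v) - f (p + r *: u) - (f (p + r *: v) - f p)
    = 'D_u ('D_v f) (p + s *: u + t *: v) * r * r].
Proof.
move=> r0 H.
have rr : 0 <= r <= r by rewrite lexx ltW.
have r00 : 0 <= (0 : R) <= r by rewrite lexx ltW.
pose g t := f (p + r *: u + t *: v) - f (p + 0 *: u + t *: v).
pose g' t := 'D_v f (p + r *: u + t *: v) - 'D_v f (p + 0 *: u + t *: v).
have dg t : 0 <= t <= r -> is_derive t 1 g (g' t).
  move=> tr; have [d1 _] := H _ _ rr tr; have [d2 _] := H _ _ r00 tr.
  exact: (is_deriveB (is_derive_line d1) (is_derive_line d2)).
have [||t tr] := @MVT_segment R g g' 0 r (ltW r0).
- by move=> x; rewrite in_itv /= => /andP[x0 xr]; apply: dg; rewrite !ltW.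
- apply: derivable_within_continuous => x; rewrite in_itv /= => /dg ?.
  exact: ex_derive.
rewrite in_itv /= in tr.
rewrite subr0 /g /g' => gE.
pose k s := 'D_v f (p + t *: v + s *: u).
pose k' s := 'D_u ('D_v f) (p + t *: v + s *: u).
have dk s : 0 <= s <= r -> is_derive s 1 k (k' s).
  move=> sr; have [_ d] := H _ _ sr tr.
  by apply: is_derive_line; rewrite addrAC.
have [||s sr] := @MVT_segment R k k' 0 r (ltW r0).
- by move=> x; rewrite in_itv /= => /andP[x0 xr]; apply: dk; rewrite !ltW.
- apply: derivable_within_continuous => x; rewrite in_itv /= => /dk ?.
  exact: ex_derive.
rewrite in_itv /= in sr.
rewrite subr0 /k /k' => kE.
exists s, t; split => //.
move: gE; rewrite !scale0r !addr0 => gE.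
rewrite (addrAC p (s *: u)) -kE scale0r addr0 (addrAC p (t *: v)) -gE.
move: (f _) (f _) (f _) (f _) => x1 x2 x3 x4.
by ring.
Qed.

(** The second difference is symmetric in [u] and [v], and it is [r * r] times either mixed
    derivative at some point near [p]; continuity at [p] then bounds the gap by every [e]. *)
Lemma derive_swap V (U : set V) (f : V -> R) p u v : open U -> U p ->
  Ck 2 U f -> 'D_u ('D_v f) p = 'D_v ('D_u f) p.
Proof.
move=> oU Up [df ddf].
apply/eqP; rewrite -subr_eq0 -normr_le0; apply/ler_addgt0Pr => e e0; rewrite add0r.
have [e20 K0] : 0 < e / 2 /\ 0 < `|u| + `|v| + 1.
  by split; [rewrite divr_gt0 | rewrite ltr_wpDl ?addr_ge0].
have cont w w' := (ddf w').2 w p Up.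
have near1 : \forall q \near p, [/\ U q,
    `|'D_u ('D_v f) p - 'D_u ('D_v f) q| < e / 2 &
    `|'D_v ('D_u f) p - 'D_v ('D_u f) q| < e / 2].
  have n1 : nbhs p U := open_nbhs_nbhs (conj oU Up).
  have n2 : \forall q \near p, `|'D_u ('D_v f) p - 'D_u ('D_v f) q| < e / 2.
    exact: ((cvgrPdist_lt _ _).1 (cont u v)).
  have n3 : \forall q \near p, `|'D_v ('D_u f) p - 'D_v ('D_u f) q| < e / 2.
    exact: ((cvgrPdist_lt _ _).1 (cont v u)).
  have fp : Filter (nbhs p) by exact: nbhs_filter.
  by apply: (filterS _ (filterI n1 (filterI n2 n3))) => q [? []].
have [d /= d0 dP] := (nbhs_ballP _ _).1 near1.
(* The parallelogram with sides [r *: u] and [r *: v] stays within distance [d / 2] of [p]; the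
   summand 1 keeps the denominator positive when [u] and [v] vanish. *)
pose r := d / 2 / (`|u| + `|v| + 1).
have r0 : 0 < r by rewrite !divr_gt0.
have inball s t : 0 <= s <= r -> 0 <= t <= r -> ball p d (p + s *: u + t *: v).
  move=> /andP[s0 sr] /andP[t0 tr].
  rewrite -ball_normE /= -addrA opprD addrA subrr add0r normrN.
  apply: (le_lt_trans (ler_normD _ _)); rewrite !normrZ !ger0_norm //.
  apply: (@le_lt_trans _ _ (r * (`|u| + `|v| + 1))).
    rewrite !mulrDr mulr1 ler_wpDr ?(ltW r0) //.
    by rewrite lerD // ler_wpM2r.
  by rewrite divfK ?gt_eqF // gtr_pMr // invf_lt1 // ltr1n.
have [|s [t [sr tr E1]]] := @second_difference _ f p u v r r0.
  move=> s t sr tr; have [Uq _ _] := dP _ (inball _ _ sr tr).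
  by split; [exact: df | exact: (ddf v).1].
have [|s' [t' [sr' tr' E2]]] := @second_difference _ f p v u r r0.
  move=> s' t' sr' tr'.
  have [Uq _ _] := dP _ (inball _ _ tr' sr'); rewrite [p + _ + _]addrAC.
  by split; [exact: df | exact: (ddf u).1].
have [_ B1 _] := dP _ (inball _ _ sr tr).
have [_ _ B2] := dP _ (inball _ _ tr' sr').
rewrite (addrAC p (s' *: v)) (addrAC p (r *: v)) in E2.
have E3 : 'D_u ('D_v f) (p + s *: u + t *: v) = 'D_v ('D_u f) (p + t' *: u + s' *: v).
  have rn : r != 0 by rewrite gt_eqF.
  have E4 : f (p + r *: u + r *: v) - f (p + r *: u) - (f (p + r *: v) - f p)
      = f (p + r *: u + r *: v) - f (p + r *: v) - (f (p + r *: u) - f p).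
    move: (f _) (f _) (f _) (f _) => x1 x2 x3 x4.
    by ring.
  have canc (a b : R) : a * r * r = b * r * r -> a = b.
    by move=> h; exact: (mulIf rn (mulIf rn h)).
  exact: canc (etrans (etrans (esym E1) E4) E2).
rewrite -E3 distrC in B2.
apply: (le_trans (ler_distD ('D_u ('D_v f) (p + s *: u + t *: v)) _ _)).
by move: (ltrD B1 B2); rewrite -splitr; exact: ltW.
Qed.
End DirectionalDerivatives.

(** * Maps of class C^k *)

Section SmoothMaps.
Context {R : realType}.
Implicit Types V W E : normedModType R.

(** Openness of [U] turns equality on [U] into equality near each point, so it passes to directional
    derivatives in the induction. *)
Lemma Ck_ext V W k (U : set V) (f g : V -> W) : open U ->
  (forall x, U x -> f x = g x) -> Ck k U f -> Ck k U g.
Proof.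
move=> oU; have near_fg (f' g' : V -> W) x : (forall x, U x -> f' x = g' x) -> U x ->
    \forall y \near x, f' y = g' y.
  move=> fg Ux; apply: (filterS _ (open_nbhs_nbhs (conj oU Ux))) => y; exact: fg.
elim: k f g => [|k IH] f g fg /=.
  move=> cf x Ux; change (g @ x --> g x); rewrite -(fg x Ux).
  exact: cvg_trans (near_eq_cvg (near_fg _ _ _ fg Ux)) (cf x Ux).
move=> [df Df]; split=> [x Ux|v].
  exact: near_differentiable (near_fg _ _ _ fg Ux) (df x Ux).
apply: IH (Df v) => x Ux.
exact: near_eq_derive (near_fg _ _ _ fg Ux).
Qed.

Lemma CkS V W k (U : set V) (f : V -> W) : Ck k.+1 U f -> Ck k U f.
Proof.
elim: k f => [|k IH] f /= [df Df].
  by move=> x Ux; apply: differentiable_continuous; exact: df.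
by split=> // v; apply: IH; exact: Df.
Qed.

Lemma Ck_cst V W k (U : set V) (a : W) : Ck k U (fun=> a).
Proof.
elim: k a => [|k IH] a /=; first by move=> x _; exact: cst_continuous.
split=> [x _|v]; first exact: differentiable_cst.
rewrite (_ : 'D_v _ = fun=> 0) //.
by apply/funext => x; exact: derive_cst.
Qed.

Lemma CkD V W k (U : set V) (f g : V -> W) : open U ->
  Ck k U f -> Ck k U g -> Ck k U (fun x => f x + g x).
Proof.
move=> oU; elim: k f g => [|k IH] f g /=.
  by move=> cf cg x Ux; apply: continuousD; [exact: cf | exact: cg].
move=> [df Df] [dg Dg]; split=> [x Ux|v].
  by apply: differentiableD; [exact: df | exact: dg].
apply: Ck_ext (IH _ _ (Df v) (Dg v)) => // x Ux.
by rewrite -deriveD //; apply: diff_derivable; [exact: df | exact: dg].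
Qed.

Lemma CkZ V W k (U : set V) (a : V -> R) (f : V -> W) : open U ->
  Ck k U a -> Ck k U f -> Ck k U (fun x => a x *: f x).
Proof.
move=> oU; elim: k a f => [|k IH] a f.
  by move=> ca cf x Ux; apply: continuousZ; [exact: ca | exact: cf].
move=> sa sf; have [da Da] := sa; have [df Df] := sf; split=> [x Ux|v].
  by apply: differentiable_scale; [exact: da | exact: df].
apply: Ck_ext (CkD oU (IH _ _ (Da v) (CkS sf)) (IH _ _ (CkS sa) (Df v))) => // x Ux.
by rewrite derive_scale //; [exact: da | exact: df].
Qed.

(** The derivative of the inverse is a product of inverses and a derivative of [a]; the inverse
    reappears one order lower, where the induction hypothesis covers it. *)
Lemma CkV V k (U : set V) (a : V -> R) : open U ->
  (forall x, U x -> a x != 0) -> Ck k U a -> Ck k U (fun x => (a x)^-1).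
Proof.
move=> oU a0; elim: k => [|k IH].
  by move=> ca x Ux; apply: continuousV; [exact: a0 | exact: ca].
move=> sa; have [da Da] := sa; split=> [x Ux|v].
  by apply: differentiableV; [exact: da | exact: a0].
have IHa := IH (CkS sa).
have h1 : Ck k U (fun x => (a x)^-1 *: ((a x)^-1 : R)) by exact: CkZ.
have h2 : Ck k U (fun x => -1 *: (((a x)^-1 *: ((a x)^-1 : R)) *: 'D_v a x)).
  apply: CkZ => //; first exact: Ck_cst.
  by apply: CkZ => //; exact: Da.
apply: Ck_ext h2 => // x Ux.
rewrite (deriveV (a0 x Ux)); last exact/diff_derivable/da.
by rewrite scaleN1r scaleNr expr2 invfM.
Qed.

Lemma Ck_linear V W k (U : set V) (L : {linear V -> W}) : continuous L -> Ck k U L.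
Proof.
move=> cL; case: k => [|k] /=; first by move=> x _; exact: cL.
split=> [x _|v]; first exact: linear_differentiable.
rewrite (_ : 'D_v _ = fun=> L v); first exact: Ck_cst.
apply/funext => x; rewrite deriveE; last exact: linear_differentiable.
by rewrite diff_lin.
Qed.

Lemma Ck_comp_linear V W E k (U : set V) (L : {linear W -> E}) (f : V -> W) :
  open U -> continuous L -> Ck k U f -> Ck k U (L \o f).
Proof.
move=> oU cL; elim: k f => [|k IH] f /=.
  by move=> cf x Ux; apply: continuous_comp; [exact: cf | exact: cL].
move=> [df Df]; split=> [x Ux|v].
  by apply: differentiable_comp; [exact: df | exact: linear_differentiable].
apply: Ck_ext (IH _ (Df v)) => // x Ux.
have dL := linear_differentiable (f x) cL.
by rewrite (derive_comp v (df x Ux) dL) (deriveE _ dL) diff_lin.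
Qed.

Lemma Ck_pair V W E k (U : set V) (f : V -> W) (g : V -> E) : open U ->
  Ck k U f -> Ck k U g -> Ck k U (fun x => (f x, g x)).
Proof.
move=> oU; elim: k f g => [|k IH] f g /=.
  by move=> cf cg x Ux; apply: cvg_pair; [exact: cf | exact: cg].
move=> [df Df] [dg Dg]; split=> [x Ux|v].
  by apply: differentiable_pair; [exact: df | exact: dg].
apply: Ck_ext (IH _ _ (Df v) (Dg v)) => // x Ux.
by rewrite derive_pair //; [exact: df | exact: dg].
Qed.

End SmoothMaps.

(** * Derivatives along moving directions in finite dimension *)

Section FiniteCoordinates.
Context {R : realType}.
Implicit Types V W E : normedModType R.

Lemma Ck_bigsum V W k (U : set V) (I : Type) (r : seq I) (F : I -> V -> W) :
  open U -> (forall i, Ck k U (F i)) -> Ck k U (fun x => \sum_(i <- r) F i x).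
Proof.
move=> oU sF; elim: r => [|i r IH].
  rewrite (_ : (fun x => _) = fun=> 0); first exact: Ck_cst.
  by apply/funext => x; rewrite big_nil.
rewrite (_ : (fun x => _) = fun x => F i x + \sum_(i <- r) F i x); first exact: CkD.
by apply/funext => x; rewrite big_cons.
Qed.

(** Finite dimension, as a finite spanning family with continuous linear coefficient forms. This
    shape passes to products and covers [R], row vectors and [tcoord] alike. *)
Definition has_coordinates E :=
  exists (I : finType) (e : I -> E) (c : I -> {linear E -> R}),
    (forall i, continuous (c i)) /\ forall v, v = \sum_i c i v *: e i.

Lemma has_coordinates_rV n : has_coordinates 'rV[R]_n.
Proof.
have lin (i : 'I_n) : linear (fun v : 'rV[R]_n => v 0 i : R).
  by move=> a u v; rewrite !mxE.
pose c i : {linear 'rV[R]_n -> R} :=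
  HB.pack (fun v : 'rV[R]_n => v 0 i : R) (GRing.isLinear.Build _ _ _ _ _ (lin i)).
exists 'I_n, (delta_mx 0), c; split; first by move=> i; exact: coord_continuous.
exact: row_sum_delta.
Qed.

Lemma has_coordinates_prod V W :
  has_coordinates V -> has_coordinates W -> has_coordinates (V * W)%type.
Proof.
move=> [I [e [c [cc ce]]]] [J [e' [c' [cc' ce']]]].
have lin1 (i : I) : linear (fun v : V * W => c i v.1 : R).
  by move=> a u v; rewrite /= linearP.
have lin2 (i : J) : linear (fun v : V * W => c' i v.2 : R).
  by move=> a u v; rewrite /= linearP.
pose d (k : I + J) : {linear (V * W)%type -> R} :=
  match k with
  | inl i => HB.pack (fun v : V * W => c i v.1 : R) (GRing.isLinear.Build _ _ _ _ _ (lin1 i))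
  | inr i => HB.pack (fun v : V * W => c' i v.2 : R) (GRing.isLinear.Build _ _ _ _ _ (lin2 i))
  end.
pose b (k : I + J) : V * W := match k with inl i => (e i, 0) | inr j => (0, e' j) end.
exists (I + J)%type, b, d; split.
  case=> [i|j] v /=.
    by apply: continuous_comp; [exact: cvg_fst | exact: cc].
  by apply: continuous_comp; [exact: cvg_snd | exact: cc'].
move=> v; rewrite big_sumType /=.
have -> : \sum_i c i v.1 *: ((e i, 0) : V * W) = (v.1, 0).
  rewrite {2}(ce v.1); elim: (index_enum I) => [|i r IH]; first by rewrite !big_nil.
  by rewrite !big_cons IH; congr pair; rewrite /= scaler0 addr0.
have -> : \sum_i c' i v.2 *: ((0, e' i) : V * W) = (0, v.2).
  rewrite {2}(ce' v.2); elim: (index_enum J) => [|i r IH]; first by rewrite !big_nil.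
  by rewrite !big_cons IH; congr pair; rewrite /= scaler0 addr0.
by case: v => v w; congr pair; rewrite /= ?addr0 ?add0r.
Qed.

(** Expanding [X q] in coordinates reduces the moving argument to finitely many scalar multiples of
    [J q (e i)]; differentiability of [J] is asked for each fixed vector, and no topology on linear
    maps enters. *)
Lemma differentiable_family V W E (J : V -> E -> W) (X : V -> E) p :
  has_coordinates E -> (\forall q \near p, linear (J q)) ->
  (forall u, differentiable (J^~ u) p) -> differentiable X p ->
  differentiable (fun q => J q (X q)) p /\
  forall w, 'D_w (fun q => J q (X q)) p = J p ('D_w X p) + 'D_w (J^~ (X p)) p.
Proof.
move=> [I [e [c [cc ce]]]] linJ dJ dX.
have sumJ q u : linear (J q) -> J q u = \sum_i c i u *: J q (e i).
  move=> lJ; pose L : {linear E -> W} := HB.pack (J q) (GRing.isLinear.Build _ _ _ _ _ lJ).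
  rewrite -[J q]/(L : E -> W) {1}(ce u) linear_sum.
  by apply: eq_bigr => i _; rewrite linearZ.
have dcX i : differentiable (fun q => c i (X q)) p.
  exact: (differentiable_comp dX (linear_differentiable _ (cc i))).
have dT i : differentiable (fun q => c i (X q) *: J q (e i)) p.
  exact: differentiable_scale.
have nearJ : \forall q \near p, \sum_i c i (X q) *: J q (e i) = J q (X q).
  by apply: filterS linJ => q lq; rewrite -sumJ.
split=> [|w]; first exact: (near_differentiable nearJ (differentiable_bigsum _ dT)).
have linJp := nbhs_singleton linJ.
rewrite -(near_eq_derive w nearJ) (derive_bigsum _ _ dT) (sumJ _ _ linJp).
have near2 : \forall q \near p, \sum_i c i (X p) *: J q (e i) = J q (X p).
  by apply: filterS linJ => q lq; rewrite -sumJ.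
rewrite -(near_eq_derive w near2) derive_bigsum; last first.
  by move=> i; apply: differentiableZ; exact: dJ.
rewrite -big_split /=; apply: eq_bigr => i _.
rewrite (derive_scale w (dcX i) (dJ (e i))).
rewrite deriveZ; last exact/diff_derivable/dJ.
congr (_ *: _ + _).
rewrite (derive_comp w dX (linear_differentiable _ (cc i))).
by rewrite deriveE ?diff_lin //; exact: (linear_differentiable _ (cc i)).
Qed.

Lemma linear_derive V W (f : V -> W) p : differentiable f p -> linear (fun u => 'D_u f p).
Proof. by move=> df a u v; rewrite derive_addv // derive_scalev. Qed.

(** The case [J q u = 'D_u g (h q)]: the second derivative of [g] appears with its inner direction
    frozen at [X p]. *)
Lemma differentiable_dir V W E (g : E -> W) (h X : V -> E) p :
  has_coordinates E ->
  (\forall q \near h p, differentiable g q) ->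
  (forall u, differentiable ('D_u g) (h p)) ->
  differentiable h p -> differentiable X p ->
  differentiable (fun q => 'D_(X q) g (h q)) p /\
  forall w, 'D_w (fun q => 'D_(X q) g (h q)) p
     = 'D_('D_w X p) g (h p) + 'D_('D_w h p) ('D_(X p) g) (h p).
Proof.
move=> cE dg ddg dh dX.
have ch : continuous_at p h by exact: differentiable_continuous.
have lin : \forall q \near p, linear (fun u => 'D_u g (h q)).
  have : \forall q \near p, differentiable g (h q) by exact: (ch _ dg).
  by apply: filterS => q; exact: linear_derive.
have dJ u : differentiable (fun q => 'D_u g (h q)) p.
  exact: (differentiable_comp dh (ddg u)).
have [dd DD] := differentiable_family cE lin dJ dX.
split=> [|w]; first exact: dd.
exact: (etrans (DD w) (congr1 _ (derive_comp w dh (ddg (X p))))).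
Qed.

Lemma Ck_dir V W k (U : set V) (f : V -> W) (X : V -> V) : has_coordinates V ->
  open U -> Ck k.+1 U f -> Ck k U X -> Ck k U (fun x => 'D_(X x) f x).
Proof.
move=> [I [e [c [cc ce]]]] oU [df Df] sX.
apply: (@Ck_ext _ _ _ _ _ (fun x => \sum_i c i (X x) *: 'D_(e i) f x)) => //.
  move=> x Ux; rewrite {2}(ce (X x)) derive_sumv; last exact: df.
  by apply: eq_bigr => i _; rewrite derive_scalev //; exact: df.
apply: Ck_bigsum => // i; apply: CkZ (Df (e i)) => //.
exact: (@Ck_comp_linear _ _ _ _ _ _ (c i)).
Qed.

Lemma has_coordinates_R : has_coordinates R.
Proof.
have lin : linear (idfun : R -> R) by [].
pose c (i : unit) : {linear R -> R} :=
  HB.pack (idfun : R -> R) (GRing.isLinear.Build _ _ _ _ _ lin).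
exists unit, (fun=> 1), c; split; first by move=> i x; exact: cvg_id.
by move=> v; rewrite (big_pred1 tt) => [|[]] //; rewrite /= [RHS]mulr1.
Qed.

Lemma smooth_differentiable V W (U : set V) (f : V -> W) p :
  smooth_on U f -> U p -> differentiable f p.
Proof. by move=> sf Up; exact: (sf 1%N).1. Qed.

Lemma smooth_derive V W (U : set V) (f : V -> W) v :
  smooth_on U f -> smooth_on U ('D_v f).
Proof. by move=> sf k; exact: (sf k.+1).2. Qed.

Lemma derive_coord V W (c : {linear W -> R}) (f : V -> W) p v :
  continuous c -> differentiable f p -> 'D_v (c \o f) p = c ('D_v f p).
Proof.
move=> cc df; have dc := linear_differentiable (f p) cc.
by rewrite (derive_comp v df dc) (deriveE _ dc) diff_lin.
Qed.

(** The coordinate forms are continuous and linear, hence commute with derivatives, which reduces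
    the claim to real-valued functions. *)
Lemma smooth_derive_swap V W (U : set V) (f : V -> W) p u v :
  has_coordinates W -> open U -> smooth_on U f -> U p ->
  'D_u ('D_v f) p = 'D_v ('D_u f) p.
Proof.
move=> [I [e [c [cc ce]]]] oU sf Up.
have DcE i w w' : c i ('D_w ('D_w' f) p) = 'D_w ('D_w' (c i \o f)) p.
  rewrite -(derive_coord _ (cc i)); last first.
    exact: smooth_differentiable (smooth_derive _ sf) Up.
  apply: near_eq_derive.
  apply: filterS (open_nbhs_nbhs (conj oU Up)) => q Uq.
  by rewrite /= (derive_coord _ (cc i)) //; exact: smooth_differentiable sf Uq.
have scf i : Ck 2 U (c i \o f) by apply: Ck_comp_linear (sf 2%N) => //; exact: cc.
have E i : c i ('D_u ('D_v f) p) = c i ('D_v ('D_u f) p).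
  exact: etrans (DcE i u v) (etrans (derive_swap u v oU Up (scf i)) (esym (DcE i v u))).
rewrite (ce ('D_u ('D_v f) p)) [RHS]ce.
by apply: eq_bigr => i _; exact: (congr1 (fun a => a *: e i) (E i)).
Qed.

Lemma smooth_dir V W (U : set V) (g : V -> W) (X : V -> V) :
  has_coordinates V -> open U -> smooth_on U g -> smooth_on U X ->
  smooth_on U (fun q => 'D_(X q) g q).
Proof. by move=> cV oU sg sX k; apply: Ck_dir. Qed.

Lemma derive_dir V W (U : set V) (g : V -> W) (X : V -> V) p w :
  has_coordinates V -> has_coordinates W ->
  open U -> smooth_on U g -> U p -> differentiable X p ->
  'D_w (fun q => 'D_(X q) g q) p = 'D_('D_w X p) g p + 'D_(X p) ('D_w g) p.
Proof.
move=> cV cW oU sg Up dX.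
have dg : \forall q \near p, differentiable g q.
  apply: filterS (open_nbhs_nbhs (conj oU Up)) => q Uq.
  exact: smooth_differentiable sg Uq.
have ddg u : differentiable ('D_u g) p.
  exact: smooth_differentiable (smooth_derive _ sg) Up.
have did : differentiable (@idfun V) p by exact: ex_diff.
have [_ DD] := differentiable_dir cV dg ddg did dX.
by rewrite (etrans (DD w) erefl) derive_id (smooth_derive_swap _ _ cW oU sg Up).
Qed.

End FiniteCoordinates.

Section SmoothOn.
Context {R : realType} {V W E : normedModType R} (U : set V) (oU : open U).
Implicit Types (f g : V -> W) (a : V -> R).

Lemma smooth_cst (w : W) : smooth_on U (fun=> w).
Proof. by move=> k; exact: Ck_cst. Qed.

Lemma smooth_ext f g : (forall x, U x -> f x = g x) -> smooth_on U f -> smooth_on U g.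
Proof. by move=> fg sf k; exact: Ck_ext (sf k). Qed.

Lemma smoothD f g : smooth_on U f -> smooth_on U g -> smooth_on U (fun x => f x + g x).
Proof. by move=> sf sg k; apply: CkD. Qed.

Lemma smoothZ a f : smooth_on U a -> smooth_on U f -> smooth_on U (fun x => a x *: f x).
Proof. by move=> sa sf k; apply: CkZ. Qed.

Lemma smoothZc (c : R) f : smooth_on U f -> smooth_on U (fun x => c *: f x).
Proof. by move=> sf k; apply: CkZ => //; exact: Ck_cst. Qed.

Lemma smoothN f : smooth_on U f -> smooth_on U (fun x => - f x).
Proof.
move=> sf; apply: smooth_ext (smoothZc (-1) sf) => x _.
by rewrite scaleN1r.
Qed.

Lemma smoothB f g : smooth_on U f -> smooth_on U g -> smooth_on U (fun x => f x - g x).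
Proof. by move=> sf sg; apply: smoothD => //; exact: smoothN. Qed.

Lemma smooth_pair f (g : V -> E) :
  smooth_on U f -> smooth_on U g -> smooth_on U (fun x => (f x, g x)).
Proof. by move=> sf sg k; apply: Ck_pair. Qed.

Lemma derive_ext f g p w : (forall x, U x -> f x = g x) -> U p -> 'D_w f p = 'D_w g p.
Proof.
move=> fg Up; apply: near_eq_derive.
by apply: filterS (open_nbhs_nbhs (conj oU Up)) => q Uq; exact: fg.
Qed.

Lemma derive_add f g p w : differentiable f p -> differentiable g p ->
  'D_w (fun x => f x + g x) p = 'D_w f p + 'D_w g p.
Proof. by move=> df dg; rewrite -deriveD //; exact: diff_derivable. Qed.

Lemma derive_opp f p w : differentiable f p -> 'D_w (fun x => - f x) p = - 'D_w f p.
Proof. by move=> df; rewrite -deriveN //; exact: diff_derivable. Qed.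

Lemma derive_sub f g p w : differentiable f p -> differentiable g p ->
  'D_w (fun x => f x - g x) p = 'D_w f p - 'D_w g p.
Proof. by move=> df dg; rewrite -deriveB //; exact: diff_derivable. Qed.

Lemma derive_scalec (c : R) f p w : differentiable f p ->
  'D_w (fun x => c *: f x) p = c *: 'D_w f p.
Proof. by move=> df; rewrite -deriveZ //; exact: diff_derivable. Qed.

End SmoothOn.

(** * Sprays in a chart *)

Section SprayInChart.
Context {R : realType} {n : nat}.
Local Notation V := (tcoord R n).
Local Notation vert u := ((0, u) : V).

Lemma has_coordinates_tcoord : has_coordinates V.
Proof. exact: has_coordinates_prod (has_coordinates_rV n) (has_coordinates_rV n). Qed.

Lemma smooth_snd (U : set V) : smooth_on U (fun q : V => q.2).
Proof.
move=> k.
pose L : {linear V -> 'rV[R]_n} := snd.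
by apply: (@Ck_linear _ _ _ _ _ L) => q; exact: cvg_snd.
Qed.

Lemma derive_snd (p w : V) : 'D_w (fun q : V => q.2) p = w.2.
Proof.
pose L : {linear V -> 'rV[R]_n} := snd.
have cL : continuous L by move=> q; exact: cvg_snd.
by rewrite (deriveE _ (linear_differentiable p cL)) (diff_lin _ cL).
Qed.

Lemma differentiable_snd (p : V) : differentiable (fun q : V => q.2) p.
Proof. exact: (smooth_differentiable (@smooth_snd setT)). Qed.

Lemma derive_vert (X : V -> 'rV[R]_n) p w : differentiable X p ->
  differentiable (fun q => vert (X q)) p /\
  'D_w (fun q => vert (X q)) p = vert ('D_w X p).
Proof.
move=> dX; have d0 : differentiable (fun=> 0 : 'rV[R]_n) p by exact: differentiable_cst.
split; first exact: differentiable_pair.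
by rewrite (derive_pair w d0 dX) derive_cst.
Qed.

Section Homogeneous.
Context (U : set V) (oU : open U).
Local Notation cV := has_coordinates_tcoord.

(** Euler's relation is differentiated along [w]; the extra term comes from the direction
    [vert q.2], which itself moves with [q]. A horizontal [w] thus keeps the degree [k], and a
    vertical [w] lowers it to [k - 1]. *)
Lemma euler_derive (W : normedModType R) (cW : has_coordinates W) (g : V -> W)
    (k : R) p w :
  smooth_on U g -> (forall q, U q -> 'D_(vert q.2) g q = k *: g q) -> U p ->
  'D_(vert p.2) ('D_w g) p = k *: 'D_w g p - 'D_(vert w.2) g p.
Proof.
move=> sg hg Up.
have [dT DT] := derive_vert w (differentiable_snd p).
have := derive_dir w cV cW oU sg Up dT.
rewrite DT derive_snd => e.
have alg (x y z : W) : x = y + z -> z = x - y by move=> ->; rewrite addrC addKr.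
apply: alg; apply: etrans e.
by rewrite -(derive_scalec k w (smooth_differentiable sg Up)) -(derive_ext oU w hg Up).
Qed.

Context (f : V -> 'rV[R]_n) (sf : smooth_on U f).
Hypothesis hf : forall q, U q -> 'D_(vert q.2) f q = 2 *: f q.

Lemma smooth_spray : smooth_on U (fun q => (q.2, f q) : V).
Proof. exact: smooth_pair (@smooth_snd U) sf. Qed.

Lemma derive_spray p w : U p -> 'D_w (fun q => (q.2, f q) : V) p = (w.2, 'D_w f p).
Proof.
move=> Up; rewrite (derive_pair w (differentiable_snd p) (smooth_differentiable sf Up)).
by rewrite derive_snd.
Qed.

(** Chart form of the relation [Delta, S] = S: the spray raises the degree of homogeneity by one. *)
Lemma euler_spray (W : normedModType R) (cW : has_coordinates W) (g : V -> W)
    (k : R) p :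
  smooth_on U g -> (forall q, U q -> 'D_(vert q.2) g q = k *: g q) -> U p ->
  'D_(vert p.2) (fun q => 'D_((q.2, f q) : V) g q) p = (k + 1) *: 'D_((p.2, f p) : V) g p.
Proof.
move=> sg hg Up.
have dg := smooth_differentiable sg Up.
rewrite (derive_dir _ cV cW oU sg Up (smooth_differentiable smooth_spray Up)).
rewrite (smooth_derive_swap _ _ cW oU sg Up) (euler_derive cW _ sg hg Up).
rewrite (derive_spray _ Up) (hf Up) /=.
have -> : (p.2, 2 *: f p) = ((p.2, f p) : V) + vert (f p).
  by congr pair; rewrite /= ?addr0 // scalerDl scale1r.
have alg (x y : W) : x + y + (k *: x - y) = (k + 1) *: x.
  by rewrite scalerDl scale1r addrCA addrK addrC.
by rewrite (derive_addv _ _ dg) alg.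
Qed.

End Homogeneous.
End SprayInChart.

(** * The Jacobi endomorphism in a chart: linearity, homogeneity, kernel *)

Section JacobiInChart.
Context {R : realType} {n : nat}.
Local Notation V := (tcoord R n).
Local Notation vert u := ((0, u) : V).
Local Notation horiz u := ((u, 0) : V).

(* The Jacobi endomorphism in a chart, for the spray coefficients [f], with [Gamma]
   written as [Gamma u = - 1/2 D_(0,u) f]. *)
Definition jac (f : V -> 'rV[R]_n) (p : V) (u : 'rV[R]_n) : 'rV[R]_n :=
  - 'D_(horiz u) f p - 4^-1 *: 'D_(vert ('D_(vert u) f p)) f p
  + 2^-1 *: 'D_((p.2, f p) : V) ('D_(vert u) f) p.

Context (U : set V) (oU : open U).
Local Notation cV := (@has_coordinates_tcoord R n).
Local Notation cW := (@has_coordinates_rV R n).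

Lemma horizP (a : R) (u v : 'rV[R]_n) : horiz (a *: u + v) = a *: horiz u + horiz v.
Proof. by congr pair; rewrite /= scaler0 addr0. Qed.

Lemma vertP (a : R) (u v : 'rV[R]_n) : vert (a *: u + v) = a *: vert u + vert v.
Proof. by congr pair; rewrite /= scaler0 addr0. Qed.

Lemma linear_derive2 (W : normedModType R) (g : V -> W) (p w : V) :
  smooth_on U g -> U p -> linear (fun u => 'D_w ('D_(vert u) g) p).
Proof.
move=> sg Up a u v.
have dD x := smooth_differentiable (smooth_derive x sg) Up.
have E q : U q -> 'D_(vert (a *: u + v)) g q = a *: 'D_(vert u) g q + 'D_(vert v) g q.
  by move=> Uq; rewrite vertP; exact: (linear_derive (smooth_differentiable sg Uq)).
apply: (etrans (derive_ext oU w E Up)).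
have dZ : differentiable (fun q => a *: 'D_(vert u) g q) p by exact: differentiableZ.
apply: (etrans (derive_add w dZ (dD (vert v)))).
by congr (_ + _); exact: derive_scalec.
Qed.

Context (f : V -> 'rV[R]_n) (sf : smooth_on U f).

Lemma jac_eq p u x y z : 'D_(horiz u) f p = x ->
  'D_(vert ('D_(vert u) f p)) f p = y -> 'D_((p.2, f p) : V) ('D_(vert u) f) p = z ->
  jac f p u = - x - 4^-1 *: y + 2^-1 *: z.
Proof. by move=> <- <- <-. Qed.

Lemma jac_linear p : U p -> linear (jac f p).
Proof.
move=> Up a u v.
have df := smooth_differentiable sf Up.
have linf := linear_derive df.
have E3 := linear_derive2 ((p.2, f p) : V) sf Up a u v.
have E1 : 'D_(horiz (a *: u + v)) f p = a *: 'D_(horiz u) f p + 'D_(horiz v) f p.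
  by rewrite horizP; exact: linf.
have E2 : 'D_(vert ('D_(vert (a *: u + v)) f p)) f p
    = a *: 'D_(vert ('D_(vert u) f p)) f p + 'D_(vert ('D_(vert v) f p)) f p.
  have E : 'D_(vert (a *: u + v)) f p = a *: 'D_(vert u) f p + 'D_(vert v) f p.
    by rewrite vertP; exact: linf.
  by apply: etrans (congr1 (fun x => 'D_(vert x) f p) E) _; rewrite vertP; exact: linf.
rewrite (jac_eq E1 E2 E3) /jac.
have alg (x x' y y' z z' : 'rV[R]_n) :
  - (a *: x + x') - 4^-1 *: (a *: y + y') + 2^-1 *: (a *: z + z')
  = a *: (- x - 4^-1 *: y + 2^-1 *: z) + (- x' - 4^-1 *: y' + 2^-1 *: z').
  by apply/rowP => i; rewrite !mxE; ring.
exact: alg.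
Qed.

Lemma smooth_vert (X : V -> 'rV[R]_n) :
  smooth_on U X -> smooth_on U (fun q => vert (X q)).
Proof. by move=> sX; apply: smooth_pair => //; exact: smooth_cst. Qed.

Lemma smooth_jac u : smooth_on U (jac f ^~ u).
Proof.
have s1 := smooth_derive (horiz u) sf.
have sv := smooth_derive (vert u) sf.
have s2 := smooth_dir cV oU sf (smooth_vert sv).
have s3 := smooth_dir cV oU sv (smooth_spray oU sf).
exact: (smoothD oU (smoothB oU (smoothN oU s1) (smoothZc oU _ s2)) (smoothZc oU _ s3)).
Qed.

Hypothesis hf : forall q, U q -> 'D_(vert q.2) f q = 2 *: f q.

Lemma euler_vert u p : U p -> 'D_(vert p.2) ('D_(vert u) f) p = 'D_(vert u) f p.
Proof.
move=> Up; rewrite (euler_derive oU cW _ sf hf Up) /=.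
have alg (x : 'rV[R]_n) : 2 *: x - x = x by rewrite scalerDl scale1r addrK.
exact: alg.
Qed.

Lemma euler_horiz u p : U p -> 'D_(vert p.2) ('D_(horiz u) f) p = 2 *: 'D_(horiz u) f p.
Proof.
move=> Up; rewrite (euler_derive oU cW _ sf hf Up) /=.
by rewrite derive0 subr0.
Qed.

(** Each of the three terms has degree 2: a horizontal derivative keeps the degree of [f], the
    middle term combines two vertical derivatives of degree 1, and the spray raises the degree of
    ['D_(vert u) f] from 1 to 2. *)
Lemma euler_jac u p : U p -> 'D_(vert p.2) (jac f ^~ u) p = 2 *: jac f p u.
Proof.
move=> Up.
have sv := smooth_derive (vert u) sf.
have s2 := smooth_dir cV oU sf (smooth_vert sv).
have s3 := smooth_dir cV oU sv (smooth_spray oU sf).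
have d1 := smooth_differentiable (smooth_derive (horiz u) sf) Up.
have d2 := smooth_differentiable s2 Up.
have d3 := smooth_differentiable s3 Up.
have dv := smooth_differentiable sv Up.
have s1 := smooth_derive (horiz u) sf.
have d1' := smooth_differentiable (smoothN oU s1) Up.
have d2' := smooth_differentiable (smoothZc oU 4^-1 s2) Up.
have d3' := smooth_differentiable (smoothZc oU 2^-1 s3) Up.
have d12 := smooth_differentiable (smoothB oU (smoothN oU s1) (smoothZc oU 4^-1 s2)) Up.
have E3 : 'D_(vert p.2) (fun q => 'D_((q.2, f q) : V) ('D_(vert u) f) q) p
    = 2 *: 'D_((p.2, f p) : V) ('D_(vert u) f) p.
  rewrite (euler_spray oU sf hf cW (k := 1) sv) // => q Uq.
  by rewrite scale1r euler_vert.
have [dvv Dvv] := derive_vert (vert p.2) dv.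
have E2 : 'D_(vert p.2) (fun q => 'D_(vert ('D_(vert u) f q)) f q) p
    = 2 *: 'D_(vert ('D_(vert u) f p)) f p.
  apply: (etrans (derive_dir _ cV cW oU sf Up dvv)).
  have alg (x y z : 'rV[R]_n) : x = z -> y = z -> x + y = 2 *: z.
    by move=> -> ->; rewrite scalerDl scale1r.
  apply: alg.
    apply: (congr1 (fun x => 'D_x f p)); apply: (etrans Dvv).
    exact: (congr1 (fun x => vert x) (euler_vert u Up)).
  exact: (etrans (smooth_derive_swap _ _ cW oU sf Up) (euler_vert _ Up)).
have E1 := euler_horiz u Up.
apply: (etrans (derive_add _ d12 d3')).
have alg (x y z x' y' z' : 'rV[R]_n) : x = 2 *: x' -> y = 2 *: y' -> z = 2 *: z' ->
  - x - 4^-1 *: y + 2^-1 *: z = 2 *: (- x' - 4^-1 *: y' + 2^-1 *: z').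
  by move=> -> -> ->; apply/rowP => i; rewrite !mxE; ring.
apply: etrans (alg _ _ _ _ _ _ E1 E2 E3).
congr (_ + _); last exact: derive_scalec.
apply: (etrans (derive_sub _ d1' d2')).
exact: (congr2 (fun x y => x - y) (derive_opp _ d1) (derive_scalec _ _ d2)).
Qed.

(** Euler's relation for [f] is differentiated along the vector [s], the value of the spray at [p].
    This expresses the second derivative in [jac] as [2 *: 'D_s f p - 'D_(vert (f p)) f p], after
    which all terms cancel. *)
Lemma jac_T p : U p -> jac f p p.2 = 0.
Proof.
move=> Up.
have df := smooth_differentiable sf Up.
pose s : V := (p.2, f p).
have [dT DT] := derive_vert s (differentiable_snd p).
have E1 := derive_dir s cV cW oU sf Up dT.
have E2 : 'D_s (fun q => 'D_(vert q.2) f q) p = 2 *: 'D_s f p.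
  by apply: (etrans (derive_ext oU s hf Up)); exact: derive_scalec.
have E3 : 'D_('D_s (fun q => vert q.2) p) f p = 'D_(vert (f p)) f p.
  by rewrite DT derive_snd.
have E4 := smooth_derive_swap (vert p.2) s cW oU sf Up.
have E5 : 'D_s f p = 'D_(horiz p.2) f p + 'D_(vert (f p)) f p.
  have -> : s = horiz p.2 + vert (f p) by congr pair; rewrite /= ?addr0 ?add0r.
  exact: derive_addv.
have E6 : 'D_(vert ('D_(vert p.2) f p)) f p = 2 *: 'D_(vert (f p)) f p.
  rewrite (hf Up); have -> : vert (2 *: f p) = 2 *: vert (f p).
    by congr pair; rewrite /= scaler0.
  exact: derive_scalev.
apply: (etrans (jac_eq erefl E6 (esym E4))).
have alg (x y z t k l : 'rV[R]_n) : l = k + z -> l = 2 *: t -> k = y -> t = x + y ->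
   - x - 4^-1 *: (2 *: y) + 2^-1 *: z = 0.
  move=> e1 e2 e3 e4; have -> : z = 2 *: (x + y) - y by rewrite -e4 -e2 e1 e3 addrC addKr.
  by apply/rowP => i; rewrite !mxE; field.
exact: alg E1 E2 E3 E5.
Qed.

End JacobiInChart.

(** * Projective change of the Jacobi endomorphism in a chart *)

Section ProjectiveChangeInChart.
Context {R : realType} {n : nat}.
Local Notation V := (tcoord R n).
Local Notation vert u := ((0, u) : V).
Local Notation horiz u := ((u, 0) : V).
Local Notation cV := (@has_coordinates_tcoord R n).
Local Notation cW := (@has_coordinates_rV R n).
Local Notation cR := (@has_coordinates_R R).

Definition pchange (f : V -> 'rV[R]_n) (P : V -> R) : V -> 'rV[R]_n :=
  fun q => f q - (2 * P q) *: q.2.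

(* [proj_b] in a chart; the horizontal lift of [u] is [(u, 1/2 D_(0,u) f)]. *)
Definition bpro (f : V -> 'rV[R]_n) (P : V -> R) (p : V) (u : 'rV[R]_n) : R :=
  3 * 'D_((u, 2^-1 *: 'D_(vert u) f p) : V) P p - P p * 'D_(vert u) P p
  - 'D_(vert u) (fun q => 'D_((q.2, f q) : V) P q) p.

Context (U : set V) (oU : open U).
Context (f : V -> 'rV[R]_n) (sf : smooth_on U f).
Hypothesis hf : forall q, U q -> 'D_(vert q.2) f q = 2 *: f q.
Context (P : V -> R) (sP : smooth_on U P).
Hypothesis hP : forall q, U q -> 'D_(vert q.2) P q = P q.

Lemma smooth_2P : smooth_on U (fun q => 2 * P q).
Proof. exact: (smoothZc oU 2 sP). Qed.

Lemma smooth_pchange : smooth_on U (pchange f P).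
Proof. exact: (smoothB oU sf (smoothZ oU smooth_2P (@smooth_snd _ _ U))). Qed.

Lemma derive_pchange p w : U p ->
  'D_w (pchange f P) p = 'D_w f p - (2 * 'D_w P p) *: p.2 - (2 * P p) *: w.2.
Proof.
move=> Up.
have df := smooth_differentiable sf Up.
have dP := smooth_differentiable sP Up.
have d2P := smooth_differentiable smooth_2P Up.
have dy := differentiable_snd p.
have dZ := smooth_differentiable (smoothZ oU smooth_2P (@smooth_snd _ _ U)) Up.
apply: (etrans (derive_sub w df dZ)).
have alg (x y z t : 'rV[R]_n) : y = z + t -> x - y = x - z - t.
  by move=> ->; rewrite opprD addrA.
apply: alg; apply: (etrans (derive_scale w d2P dy)).
by rewrite derive_snd (derive_scalec 2 w dP).
Qed.

Lemma euler_pchange p : U p -> 'D_(vert p.2) (pchange f P) p = 2 *: pchange f P p.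
Proof.
move=> Up; apply: (etrans (derive_pchange _ Up)); rewrite (hf Up) (hP Up) /pchange /=.
by apply/rowP => i; rewrite !mxE; ring.
Qed.

Lemma euler_vertP u p : U p -> 'D_(vert p.2) ('D_(vert u) P) p = 0.
Proof.
move=> Up; have hP1 q : U q -> 'D_(vert q.2) P q = 1 *: P q.
  by move=> Uq; rewrite scale1r hP.
apply: (etrans (euler_derive oU cR _ sP hP1 Up)).
by rewrite scale1r subrr.
Qed.

(** The horizontal lift and the derivative of the spray direction contribute the same kinds of
    terms: the coefficient is 3 - 1 on the horizontal part and 3/2 - 1 on the part along
    ['D_(vert u) f p]. *)
Lemma bpro_eq p u : U p -> bpro f P p u =
  2 * 'D_(horiz u) P p + 2^-1 * 'D_(vert ('D_(vert u) f p)) P p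
  - P p * 'D_(vert u) P p - 'D_((p.2, f p) : V) ('D_(vert u) P) p.
Proof.
move=> Up.
have dP := smooth_differentiable sP Up.
have dS := smooth_differentiable (smooth_spray oU sf) Up.
set v := 'D_(vert u) f p.
have splitE (x y : 'rV[R]_n) : 'D_((x, y) : V) P p = 'D_(horiz x) P p + 'D_(vert y) P p.
  have -> : (x, y) = horiz x + vert y by congr pair; rewrite /= ?addr0 ?add0r.
  exact: derive_addv.
have E1 : 'D_((u, 2^-1 *: v) : V) P p = 'D_(horiz u) P p + 2^-1 * 'D_(vert v) P p.
  apply: (etrans (splitE _ _)); congr (_ + _).
  have -> : vert (2^-1 *: v) = 2^-1 *: vert v by congr pair; rewrite /= scaler0.
  exact: derive_scalev.
have E2 : 'D_(vert u) (fun q => 'D_((q.2, f q) : V) P q) p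
  = 'D_(horiz u) P p + 'D_(vert v) P p + 'D_((p.2, f p) : V) ('D_(vert u) P) p.
  apply: (etrans (derive_dir _ cV cR oU sP Up dS)).
  apply: (congr2 (fun x y => x + y) _ erefl).
  exact: (etrans (congr1 (fun x => 'D_x P p) (derive_spray sf (vert u) Up)) (splitE u v)).
have alg (h k l m a b c d : R) : a = h + 2^-1 * k -> b = h + k + l ->
   3 * a - c * d - b = 2 * h + 2^-1 * k - c * d - l.
  by move=> -> ->; field.
exact: (alg _ _ _ 0 _ _ _ _ E1 E2).
Qed.

Lemma bpro_linear p : U p -> linear (bpro f P p : 'rV[R]_n -> R^o).
Proof.
move=> Up a u v.
have dP := smooth_differentiable sP Up.
have linP := linear_derive dP.
have linf := linear_derive (smooth_differentiable sf Up).
have F1 : 'D_(horiz (a *: u + v)) P p = a *: 'D_(horiz u) P p + 'D_(horiz v) P p.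
  by rewrite horizP; exact: linP.
have F2 : 'D_(vert (a *: u + v)) P p = a *: 'D_(vert u) P p + 'D_(vert v) P p.
  by rewrite vertP; exact: linP.
have F3 : 'D_(vert ('D_(vert (a *: u + v)) f p)) P p
  = a *: 'D_(vert ('D_(vert u) f p)) P p + 'D_(vert ('D_(vert v) f p)) P p.
  have E : 'D_(vert (a *: u + v)) f p = a *: 'D_(vert u) f p + 'D_(vert v) f p.
    by rewrite vertP; exact: linf.
  apply: (etrans (congr1 (fun x => 'D_(vert x) P p) E)); rewrite vertP; exact: linP.
have F4 := linear_derive2 oU ((p.2, f p) : V) sP Up a u v.
apply: (etrans (bpro_eq _ Up)).
apply: (etrans _ (esym (congr2 (fun x y : R => a * x + y) (bpro_eq u Up) (bpro_eq v Up)))).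
have alg (x1 x2 x3 x4 y1 y2 y3 y4 z1 z2 z3 z4 c : R) :
  x1 = a * y1 + z1 -> x2 = a * y2 + z2 -> x3 = a * y3 + z3 -> x4 = a * y4 + z4 ->
  2 * x1 + 2^-1 * x3 - c * x2 - x4 =
  a * (2 * y1 + 2^-1 * y3 - c * y2 - y4) + (2 * z1 + 2^-1 * z3 - c * z2 - z4).
  by move=> -> -> -> ->; ring.
exact: alg F1 F2 F3 F4.
Qed.

(** Every derivative along the Liouville direction is evaluated by Euler's relation, with degree 2
    for [f], 1 for [P] and ['D_(vert u) f], and 0 for ['D_(vert u) P]. What remains is linear
    algebra, with the coefficient of [p.2] in the form of [bpro_eq]. *)
Lemma jac_pchange p u : U p -> jac (pchange f P) p u
  = jac f p u + (P p ^+ 2 - 'D_((p.2, f p) : V) P p) *: u + bpro f P p u *: p.2.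
Proof.
move=> Up.
have df := smooth_differentiable sf Up.
have dP := smooth_differentiable sP Up.
have dfu := smooth_differentiable (smooth_derive (vert u) sf) Up.
have dPu := smooth_differentiable (smooth_derive (vert u) sP) Up.
pose y := p.2; pose s : V := (y, f p).
pose v := 'D_(vert u) f p.
pose Pu := 'D_(vert u) P p.
(* [v] and [v'] are -2 times Gamma of the old and of the changed spray, applied to [u]. *)
pose v' := v - (2 * Pu) *: y - (2 * P p) *: u.
pose s' : V := (y, pchange f P p).
have linP := linear_derive dP.
have E1 : 'D_(horiz u) (pchange f P) p = 'D_(horiz u) f p - (2 * 'D_(horiz u) P p) *: y.
  by apply: (etrans (derive_pchange _ Up)); rewrite scaler0 subr0.
have Ev : 'D_(vert u) (pchange f P) p = v' by exact: derive_pchange.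
have v'E : vert v' = vert v - (2 * Pu) *: vert y - (2 * P p) *: vert u.
  by congr pair; rewrite /= !scaler0 !subr0.
have dirE (W : normedModType R) (g : V -> W) : differentiable g p ->
  'D_(vert v') g p = 'D_(vert v) g p - (2 * Pu) *: 'D_(vert y) g p - (2 * P p) *: 'D_(vert u) g p.
  move=> dg; rewrite v'E.
  apply: (etrans (derive_addv _ _ dg)).
  apply: (congr2 (fun x y => x + y)).
    apply: (etrans (derive_addv _ _ dg)); apply: (congr2 (fun x y => x + y) erefl).
    by apply: (etrans (derive_oppv _ dg)); apply: (congr1 (fun x => - x)); exact: derive_scalev.
  by apply: (etrans (derive_oppv _ dg)); apply: (congr1 (fun x => - x)); exact: derive_scalev.
have dirS (W : normedModType R) (g : V -> W) : differentiable g p ->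
  'D_s' g p = 'D_s g p - (2 * P p) *: 'D_(vert y) g p.
  move=> dg; have -> : s' = s - (2 * P p) *: vert y.
    by congr pair; rewrite /= ?scaler0 ?subr0.
  apply: (etrans (derive_addv _ _ dg)); apply: (congr2 (fun x y => x + y) erefl).
  by apply: (etrans (derive_oppv _ dg)); apply: (congr1 (fun x => - x)); exact: derive_scalev.
have E2 : 'D_(vert ('D_(vert u) (pchange f P) p)) (pchange f P) p
  = 'D_(vert v) f p - (4 * Pu) *: f p - (2 * P p) *: v
    - (2 * ('D_(vert v) P p - 4 * Pu * P p)) *: y - (2 * P p) *: v'.
  apply: (etrans (congr1 (fun x => 'D_(vert x) (pchange f P) p) Ev)).
  apply: (etrans (derive_pchange _ Up)).
  have e1 := dirE _ f df; have e2 := dirE _ P dP.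
  have e3 := hf Up; have e4 := hP Up.
  have alg (x1 x2 x3 x4 x5 : 'rV[R]_n) (r1 r2 r3 : R) :
    x1 = x2 - (2 * Pu) *: x3 - (2 * P p) *: v -> r1 = r2 - (2 * Pu) *: r3 - (2 * P p) *: Pu ->
    x3 = 2 *: x4 -> r3 = P p ->
    x1 - (2 * r1) *: y - (2 * P p) *: x5 =
    x2 - (4 * Pu) *: x4 - (2 * P p) *: v - (2 * (r2 - 4 * Pu * P p)) *: y - (2 * P p) *: x5.
    move=> -> -> -> ->; apply/rowP => i; rewrite !mxE /GRing.scale /=; ring.
  exact: (alg _ _ _ _ _ _ _ _ e1 e2 e3 e4).
have E3 : 'D_s' ('D_(vert u) (pchange f P)) p = 'D_s ('D_(vert u) f) p - (2 * P p) *: v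
    - (2 * 'D_s ('D_(vert u) P) p) *: y - (2 * Pu) *: pchange f P p
    - (2 * ('D_s P p - 2 * P p ^+ 2)) *: u.
  apply: (etrans (derive_ext oU s' (fun q Uq => derive_pchange (vert u) Uq) Up)).
  have sPu := smoothZc oU 2 (smooth_derive (vert u) sP).
  have sA := smoothZ oU sPu (@smooth_snd _ _ U).
  have sB := smoothZ oU smooth_2P (smooth_cst U u).
  have dA := smooth_differentiable sA Up.
  have dB := smooth_differentiable sB Up.
  have dfA := smooth_differentiable (smoothB oU (smooth_derive (vert u) sf) sA) Up.
  have e1 := dirS _ _ dfu; have e2 := dirS _ _ dPu; have e3 := dirS _ _ dP.
  have e4 := euler_vert oU sf hf u Up; have e5 := euler_vertP u Up; have e6 := hP Up.
  have e7 : 'D_s' (fun q => (2 *: 'D_(vert u) P q) *: q.2) p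
     = (2 * 'D_s' ('D_(vert u) P) p) *: y + (2 * Pu) *: pchange f P p.
    apply: (etrans (derive_scale s' (smooth_differentiable sPu Up) (differentiable_snd p))).
    by rewrite derive_snd (derive_scalec 2 s' dPu).
  have e8 : 'D_s' (fun q => (2 * P q) *: u) p = (2 * 'D_s' P p) *: u.
    apply: (etrans (derive_scale s' (smooth_differentiable smooth_2P Up)
      (smooth_differentiable (smooth_cst U u) Up))).
    by rewrite derive_cst scaler0 addr0 (derive_scalec 2 s' dP).
  apply: (etrans (derive_sub s' dfA dB)).
  apply: (etrans (congr2 (fun x y => x - y) (derive_sub s' dfu dA) e8)).
  have alg (x1 x2 x3 x4 x5 : 'rV[R]_n) (r1 r2 r3 r4 r5 r6 : R) :
    x1 = x2 - (2 * P p) *: x3 -> x3 = v ->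
    r1 = r2 - (2 * P p) *: r3 -> r3 = 0 -> r4 = r5 - (2 * P p) *: r6 -> r6 = P p ->
    x4 = (2 * r1) *: y + x5 ->
    x1 - x4 - (2 * r4) *: u = x2 - (2 * P p) *: v - (2 * r2) *: y - x5
       - (2 * (r5 - 2 * P p ^+ 2)) *: u.
    move=> -> -> -> -> -> -> ->; apply/rowP => i; rewrite !mxE /GRing.scale /=; ring.
  exact: (alg _ _ _ _ _ _ _ _ _ _ _ e1 e4 e2 e5 e3 e6 e7).
apply: (etrans (jac_eq E1 E2 E3)).
apply: (etrans _ (esym (congr1 (fun x => jac f p u + (P p ^+ 2 - 'D_s P p) *: u + x *: y)
  (bpro_eq u Up)))).
rewrite /jac /v' /pchange -/s -/y -/v -/Pu.
have alg (x1 x2 x3 x4 x5 : 'rV[R]_n) (r1 r2 r3 r4 r5 r6 : R) :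
  - (x1 - (2 * r1) *: y) - 4^-1 *: (x2 - (4 * r2) *: x3 - (2 * r3) *: x4
     - (2 * (r4 - 4 * r2 * r3)) *: y - (2 * r3) *: (x4 - (2 * r2) *: y - (2 * r3) *: u))
  + 2^-1 *: (x5 - (2 * r3) *: x4 - (2 * r5) *: y - (2 * r2) *: (x3 - (2 * r3) *: y)
     - (2 * (r6 - 2 * r3 ^+ 2)) *: u)
  = - x1 - 4^-1 *: x2 + 2^-1 *: x5 + (r3 ^+ 2 - r6) *: u
    + (2 * r1 + 2^-1 * r4 - r3 * r2 - r5) *: y.
  by apply/rowP => i; rewrite !mxE; field.
exact: alg.
Qed.

End ProjectiveChangeInChart.

(** On the line [p + t *: v] the function is affine in [t] as long as [1 + t] is positive, hence
    near [t = 0]; [v] stands for the Liouville direction. *)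
Lemma derive_homogeneous1 {R : realType} {V : normedModType R} (F : V -> R) (p v : V) :
  differentiable F p -> (forall t : R, 0 < 1 + t -> F (p + t *: v) = (1 + t) * F p) ->
  'D_v F p = F p.
Proof.
move=> dF hF.
have dF0 : differentiable F (p + 0 *: v) by rewrite scale0r addr0.
have [_ E1] := is_derive_line dF0; rewrite scale0r addr0 in E1.
rewrite -E1.
have nearE : \forall t \near (0 : R), F (p + t *: v) = id (F p + t *: F p).
  have m1 : (0 : R) \in [set t : R | -1 < t] by rewrite inE /= ltrN10.
  have oG : open [set t : R | -1 < t] by exact: open_gt.
  apply: filterS (open_nbhs_nbhs (conj oG (set_mem m1))) => t /= t1.
  by rewrite hF -?ltrBlDl ?sub0r // mulrDl mul1r.
apply: (etrans (near_eq_derive _ nearE)).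
have did : differentiable (@id R) (F p + 0 *: F p) by exact: ex_diff.
have [_ ->] := is_derive_line did.
exact: derive_id.
Qed.

(** * From fields along tau to their components *)

Section Charts.
Context {R : realType} {n : nat} (M : smooth_manifold R n).
Local Notation V := (tcoord R n).
Local Notation vert u := ((0, u) : V).
Local Notation horiz u := ((u, 0) : V).

Lemma open_chart_image (a : chart M) : open (chart_map a @` chart_dom a).
Proof. by case: M a. Qed.

Lemma open_fst_snd_neq0 (U : set 'rV[R]_n) : open U -> open [set p : V | U p.1 /\ p.2 != 0].
Proof.
move=> oU.
have -> : [set p : V | U p.1 /\ p.2 != 0]
    = (fst @^-1` U) `&` (snd @^-1` (~` [set (0 : 'rV[R]_n)])).
  by apply/seteqP; split=> p /= [h1 h2]; split=> //; apply/eqP.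
apply: openI; apply: open_comp => //.
- by move=> p _; exact: cvg_fst.
- by move=> p _; exact: cvg_snd.
- apply: closed_openC.
  exact: (accessible_closed_set1 (hausdorff_accessible (@norm_hausdorff _ _))).
Qed.

Lemma open_slit (a : chart M) : open (slit a).
Proof. exact: (open_fst_snd_neq0 (@open_chart_image a)). Qed.

Lemma smooth_comp_snd (W : normedModType R) (U : set W) (F : W -> V) : open U ->
  smooth_on U F -> smooth_on U (fun q => (F q).2).
Proof.
move=> oU sF k.
pose L : {linear V -> 'rV[R]_n} := snd.
by apply: (@Ck_comp_linear _ _ _ _ _ _ L) => // q; exact: cvg_snd.
Qed.

Lemma derive_comp_snd (F : V -> V) p w : differentiable F p ->
  'D_w (fun q => (F q).2) p = ('D_w F p).2.
Proof.
move=> dF; apply: (etrans (derive_comp w dF (differentiable_snd (F p)))).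
exact: derive_snd.
Qed.

Lemma derive_entry (W : normedModType R) (F : W -> 'rV[R]_n) p w k :
  differentiable F p -> 'D_w (fun q => F q 0 k) p = ('D_w F p) 0 k.
Proof.
by move=> dF; rewrite (derive_mx (diff_derivable (v := w) dF)) mxE.
Qed.

(** * Index formulas against derivatives along vectors *)

Section Bridge.
Context (S : tfield M) (a : chart M).
Local Notation f := (fun q : V => (S a q).2).

Lemma GamE p k j : differentiable f p ->
  Gam S k j a p = - 2^-1 * ('D_(vert (delta_mx 0 j)) f p) 0 k.
Proof.
by move=> df; rewrite /Gam /dxdot /spray_coef (derive_entry _ _ df).
Qed.

Lemma sum_GamE p k (u : 'rV[R]_n) : differentiable f p ->
  \sum_(j < n) Gam S k j a p * u 0 j = - 2^-1 * ('D_(vert u) f p) 0 k.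
Proof.
move=> df.
have E : 'D_(vert u) f p = \sum_j u 0 j *: 'D_(vert (delta_mx 0 j)) f p.
  have -> : vert u = \sum_j u 0 j *: vert (delta_mx 0 j).
    rewrite {1}(row_sum_delta u); elim: (index_enum _) => [|i r IH]; first by rewrite !big_nil.
    by rewrite !big_cons -IH; congr pair; rewrite /= ?scaler0 ?addr0.
  apply: (etrans (derive_sumv _ df)); apply: eq_bigr => j _.
  exact: derive_scalev.
rewrite E summxE mulr_sumr; apply: eq_bigr => j _.
by rewrite (GamE _ _ df) [in RHS]mxE -mulrA; congr (_ * _); rewrite mulrC.
Qed.

Lemma nablaE (X : along M) p : differentiable f p -> differentiable (X a) p ->
  nabla S X a p = 'D_(S a p) (X a) p - 2^-1 *: 'D_(vert (X a p)) f p.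
Proof.
move=> df dX; apply/rowP => k; rewrite !mxE (sum_GamE _ _ df) /lie_der /component.
by rewrite (derive_entry _ _ dX) mulNr.
Qed.

Lemma hliftE (X : along M) p : differentiable f p ->
  hlift S X a p = (X a p, 2^-1 *: 'D_(vert (X a p)) f p).
Proof.
move=> df; congr pair; apply/rowP => k; rewrite !mxE (sum_GamE _ _ df).
by rewrite mulNr opprK.
Qed.

Hypothesis S1 : forall q, slit a q -> (S a q).1 = q.2.
Hypothesis sS : smooth_on (slit a) (S a).

Lemma sprayE q : slit a q -> S a q = (q.2, f q).
Proof. by move=> sq; rewrite -(S1 sq); case: (S a q). Qed.

Let sf : smooth_on (slit a) f.
Proof. exact: (smooth_comp_snd (@open_slit a) sS). Qed.

(** Both sides are linear in the value at [p], so basis vectors suffice. Gamma carries the factor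
    -1/2, which produces the constants 1/4 and 1/2 of [jac]. *)
Lemma JacobiE (X : along M) p : slit a p -> Jacobi S X a p = jac f p (X a p).
Proof.
move=> sp.
have df := smooth_differentiable sf sp.
have compE k j : Jacobi_comp S k j a p = (jac f p (delta_mx 0 j)) 0 k.
  have d2 := smooth_differentiable (smooth_derive (vert (delta_mx 0 j)) sf) sp.
  rewrite /Jacobi_comp /jac !mxE.
  have -> : dx j (spray_coef S k) a p = ('D_(horiz (delta_mx 0 j)) f p) 0 k.
    exact: derive_entry.
  have -> : \sum_(m < n) Gam S m j a p * Gam S k m a p
     = 4^-1 * ('D_(vert ('D_(vert (delta_mx 0 j)) f p)) f p) 0 k.
    rewrite (eq_bigr (fun m => - 2^-1 * (Gam S k m a p * ('D_(vert (delta_mx 0 j)) f p) 0 m))).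
      rewrite -mulr_sumr (sum_GamE _ _ df) mulrA; congr (_ * _).
      by rewrite mulrNN -invfM -natrM.
    by move=> m _; rewrite (GamE _ _ df) mulrCA mulrAC -mulrA mulrC -mulrA.
  have -> : lie_der S (Gam S k j) a p
     = - 2^-1 * ('D_((p.2, f p) : V) ('D_(vert (delta_mx 0 j)) f) p) 0 k.
    rewrite /lie_der -(sprayE sp).
    have E q : slit a q -> Gam S k j a q = (- 2^-1) *: ('D_(vert (delta_mx 0 j)) f q) 0 k.
      by move=> sq; exact: (GamE _ _ (smooth_differentiable sf sq)).
    apply: (etrans (derive_ext (@open_slit a) _ E sp)).
    apply: (etrans (derive_scalec _ _ _)); last by rewrite (derive_entry _ _ d2).
    exact: (differentiable_comp d2 (differentiable_coord _ _ _)).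
  by rewrite mulNr opprK.
have lin := jac_linear (@open_slit a) sf sp.
pose L : {linear 'rV[R]_n -> 'rV[R]_n} := HB.pack (jac f p) (GRing.isLinear.Build _ _ _ _ _ lin).
apply/rowP => k; rewrite mxE -[jac f p]/(L : _ -> _) [in RHS](row_sum_delta (X a p)).
rewrite linear_sum summxE; apply: eq_bigr => j _.
by rewrite linearZ /= mxE compE mulrC.
Qed.

(** The second component of [Delta, S] = S reads Delta f - f = f. *)
Lemma euler_of_bracket p : slit a p -> lie_bracket (@Liouville R n M) S a p = S a p ->
  'D_(vert p.2) f p = 2 *: f p.
Proof.
move=> sp e.
have dS := smooth_differentiable sS sp.
apply: (etrans (derive_comp_snd _ dS)).
have E2 : 'D_(S a p) (Liouville a) p = vert (f p).
  have [_ ->] := derive_vert (S a p) (differentiable_snd p).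
  by rewrite derive_snd.
move: e; rewrite /lie_bracket E2 => /(congr1 snd) /= e.
have alg (x y : 'rV[R]_n) : x - y = y -> x = 2 *: y.
  by move=> h; rewrite -[x](subrK y) h scalerDl scale1r.
exact: alg e.
Qed.

Lemma proj_bE (P : func M) (X : along M) p : smooth_on (slit a) (P a) -> slit a p ->
  proj_b S P X a p = bpro f (P a) p (X a p).
Proof.
move=> sP sp; have df := smooth_differentiable sf sp.
rewrite /proj_b /bpro /lie_der (hliftE _ df).
apply: (congr1 (fun x => 3 * 'D_((X a p, 2^-1 *: 'D_(vert (X a p)) f p) : V) (P a) p
  - P a p * 'D_(vert (X a p)) (P a) p - x)).
apply: (derive_ext (@open_slit a) _ _ sp) => q sq.
by rewrite (sprayE sq).
Qed.

Lemma proj_change1 (P : func M) q : slit a q -> (proj_change S P a q).1 = q.2.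
Proof. by move=> sq; rewrite /= scaler0 subr0 S1. Qed.

Lemma smooth_proj_change (P : func M) : smooth_on (slit a) (P a) ->
  smooth_on (slit a) (proj_change S P a).
Proof.
move=> sP; apply: smoothB => //; first exact: open_slit.
have oU := @open_slit a.
apply: (smoothZ oU (smoothZc oU 2 sP)).
by apply: (smooth_vert oU); exact: smooth_snd.
Qed.

End Bridge.

Lemma euler_of_homogeneous1 (P : func M) a p : homogeneous1 P -> slit a p ->
  smooth_on (slit a) (P a) -> 'D_(vert p.2) (P a) p = P a p.
Proof.
move=> hP sp sP; apply: derive_homogeneous1; first exact: smooth_differentiable sP sp.
move=> t t0; rewrite -(hP a p _ sp t0); congr (P a _).
by case: p sp => x y sp; congr pair; rewrite /= ?scaler0 ?addr0 // scalerDl scale1r.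
Qed.

End Charts.

(** * Changes of charts *)

Section ChangeOfCharts.
Context {R : realType} {n : nat} (M : smooth_manifold R n).
Local Notation V := (tcoord R n).
Local Notation vert u := ((0, u) : V).
Local Notation cV := (@has_coordinates_tcoord R n).
Local Notation cW := (@has_coordinates_rV R n).

Lemma chart_invK (a : chart M) m : chart_dom a m -> chart_inv a (chart_map a m) = m.
Proof. by case: M a m. Qed.

Lemma open_chart_dom (a : chart M) : open (chart_dom a).
Proof. by case: M a. Qed.

Lemma continuous_chart_inv (a : chart M) :
  {within chart_map a @` chart_dom a, continuous (chart_inv a)}.
Proof. by case: M a. Qed.

Definition overlap (a b : chart M) : set 'rV[R]_n :=
  chart_map a @` (chart_dom a `&` chart_dom b).

Lemma smooth_chart_trans (a b : chart M) : smooth_on (overlap a b) (chart_trans a b).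
Proof. by rewrite /overlap /chart_trans; case: M a b. Qed.

(** Inside the open image of chart [a], the overlap is the preimage of the open domain of [b] under
    the continuous map [chart_inv a]. *)
Lemma open_overlap (a b : chart M) : open (overlap a b).
Proof.
have oI := @open_chart_image R n M a.
have := @continuous_chart_inv a.
rewrite continuous_open_subspace // => cinv.
rewrite openE => _ [m [am bm] <-].
have Im : (chart_map a @` chart_dom a) (chart_map a m) by exists m.
have n1 : nbhs (chart_map a m) (chart_map a @` chart_dom a).
  exact: open_nbhs_nbhs (conj oI Im).
have n2 : nbhs (chart_map a m) (chart_inv a @^-1` (chart_dom b)).
  apply: (cinv _ (mem_set Im)); rewrite chart_invK //.
  exact: open_nbhs_nbhs (conj (open_chart_dom b) bm).
apply: filterS (filterI n1 n2) => _ [[m' am' <-]] /=.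
by rewrite chart_invK // => bm'; exists m'.
Qed.

Lemma chart_transK (a b : chart M) x : overlap a b x ->
  overlap b a (chart_trans a b x) /\ chart_trans b a (chart_trans a b x) = x.
Proof.
move=> [m [am bm] <-]; rewrite /chart_trans /= chart_invK //.
by rewrite chart_invK //; split=> //; exists m.
Qed.

(** The reverse transition inverts the differential as well. This is what keeps [tchart_trans]
    inside the slit bundle. *)
Lemma derive_chart_trans_neq0 (a b : chart M) x u : overlap a b x -> u != 0 ->
  'D_u (chart_trans a b) x != 0.
Proof.
move=> ox u0; apply/eqP => D0.
have [ox' _] := chart_transK ox.
have d1 := smooth_differentiable (@smooth_chart_trans a b) ox.
have d2 := smooth_differentiable (@smooth_chart_trans b a) ox'.
have E := derive_comp u d1 d2.
have E2 : 'D_u (chart_trans b a \o chart_trans a b) x = u.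
  apply: (etrans (derive_ext (@open_overlap a b) (g := id) u _ ox)); last exact: derive_id.
  by move=> q oq; have [_ /=] := chart_transK oq.
rewrite D0 derive0 in E.
by move: u0; rewrite -E2 E eqxx.
Qed.

Lemma slit_overlap_slit (a b : chart M) p : slit_overlap a b p -> slit a p.
Proof. by move=> [[m [am bm] e] p0]; split=> //; exists m. Qed.

Lemma slit_tchart_trans (a b : chart M) p : slit_overlap a b p ->
  slit b (tchart_trans a b p).
Proof.
move=> [op p0]; split; last exact: derive_chart_trans_neq0.
by have [[m [bm am] e] _] := chart_transK op; exists m.
Qed.

Lemma open_slit_overlap (a b : chart M) : open (slit_overlap a b).
Proof. exact: (open_fst_snd_neq0 (@open_overlap a b)). Qed.

Lemma derive_fst (p w : V) :
  differentiable (fun q : V => q.1) p /\ 'D_w (fun q : V => q.1) p = w.1.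
Proof.
pose L : {linear V -> 'rV[R]_n} := fst.
have cL : continuous L by move=> q; exact: cvg_fst.
have dL := linear_differentiable p cL.
by split; [exact: dL | rewrite (deriveE _ dL) (diff_lin _ cL)].
Qed.

Section Overlap.
Context (a b : chart M).
Local Notation phi := (chart_trans a b).
Local Notation T := (tchart_trans a b).

Lemma derive_along_fst (g : 'rV[R]_n -> 'rV[R]_n) (X : V -> 'rV[R]_n) p :
  smooth_on (overlap a b) g -> overlap a b p.1 -> differentiable X p ->
  differentiable (fun q => 'D_(X q) g q.1) p /\
  forall w, 'D_w (fun q => 'D_(X q) g q.1) p
    = 'D_('D_w X p) g p.1 + 'D_(w.1) ('D_(X p) g) p.1.
Proof.
move=> sg op dX.
have dg : \forall q \near p.1, differentiable g q.
  apply: filterS (open_nbhs_nbhs (conj (@open_overlap a b) op)) => q oq.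
  exact: smooth_differentiable sg oq.
have ddg u : differentiable ('D_u g) p.1.
  exact: smooth_differentiable (smooth_derive u sg) op.
have [d1 D1] := differentiable_dir cW dg ddg (derive_fst p 0).1 dX.
split=> [|w]; first exact: d1.
apply: (etrans (D1 w)).
exact: (congr1 (fun x => _ + 'D_x ('D_(X p) g) p.1) (derive_fst p w).2).
Qed.

(** The last summand, a Hessian of the transition map, is the source of the non-tensorial behaviour
    of the spray coefficients and of Gamma; it vanishes on vertical vectors. *)
Lemma derive_tchart_trans p : overlap a b p.1 ->
  differentiable T p /\
  forall w, 'D_w T p = ('D_(w.1) phi p.1, 'D_(w.2) phi p.1 + 'D_(w.1) ('D_(p.2) phi) p.1).
Proof.
move=> op; have sphi := @smooth_chart_trans a b.
have [d2 D2] := derive_along_fst sphi op (differentiable_snd p).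
have dphi := smooth_differentiable sphi op.
have dfst := (derive_fst p 0).1.
have d1 : differentiable (fun q : V => phi q.1) p.
  exact: (differentiable_comp dfst dphi).
split=> [|w]; first exact: differentiable_pair.
apply: (etrans (derive_pair w d1 d2)).
by rewrite D2 derive_snd.
Qed.

Lemma derive_tchart_trans_vert p u : overlap a b p.1 ->
  'D_(vert u) T p = vert ('D_u phi p.1).
Proof.
by move=> op; rewrite (derive_tchart_trans op).2 /= !derive0 addr0.
Qed.

Lemma derive_along_trans (X : along M) p w : is_along X -> slit_overlap a b p ->
  'D_('D_w T p) (X b) (T p) = 'D_('D_w (X a) p) phi p.1 + 'D_(w.1) ('D_(X a p) phi) p.1.
Proof.
move=> [sX tX] sp; have [op p0] := sp.
have dX := smooth_differentiable (sX a) (slit_overlap_slit sp).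
have dXb := smooth_differentiable (sX b) (slit_tchart_trans sp).
have [_ D1] := derive_along_fst (@smooth_chart_trans a b) op dX.
apply: (etrans (esym (derive_comp w (derive_tchart_trans op).1 dXb))).
apply: (etrans (derive_ext (@open_slit_overlap a b) w _ sp) (D1 w)).
by move=> q sq; exact: tX.
Qed.

(* The two arguments of the Hessian are differentiated one after the other; its
   symmetry turns the second term into a copy of the first. *)
Lemma derive_hessian p u : overlap a b p.1 ->
  differentiable (fun q : V => 'D_(q.2) ('D_(q.2) phi) q.1) p /\
  'D_(vert u) (fun q : V => 'D_(q.2) ('D_(q.2) phi) q.1) p = 2 *: 'D_u ('D_(p.2) phi) p.1.
Proof.
move=> op; have sphi := @smooth_chart_trans a b.
have oU : open [set q : V | overlap a b q.1].
  by apply: open_comp; [move=> q _; exact: cvg_fst | exact: open_overlap].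
have swap (q : V) v : overlap a b q.1 ->
    'D_v ('D_(q.2) phi) q.1 = 'D_(q.2) ('D_v phi) q.1.
  exact: (smooth_derive_swap _ _ cW (@open_overlap a b) sphi).
have lin : \forall q \near p, linear (fun v => 'D_v ('D_(q.2) phi) q.1).
  apply: filterS (open_nbhs_nbhs (conj oU op)) => q oq.
  exact: (linear_derive (smooth_differentiable (smooth_derive _ sphi) oq)).
have near_swap v : \forall q \near p, 'D_(q.2) ('D_v phi) q.1 = 'D_v ('D_(q.2) phi) q.1.
  apply: filterS (open_nbhs_nbhs (conj oU op)) => q oq.
  exact: (esym (swap q v oq)).
have dirv v := derive_along_fst (smooth_derive v sphi) op (differentiable_snd p).
have dJ v : differentiable (fun q : V => 'D_v ('D_(q.2) phi) q.1) p.
  exact: near_differentiable (near_swap v) (dirv v).1.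
have [d1 D1] := differentiable_family cW lin dJ (differentiable_snd p).
split; first exact: d1.
apply: (etrans (D1 (vert u))); rewrite derive_snd /=.
have E : 'D_(vert u) (fun q : V => 'D_(p.2) ('D_(q.2) phi) q.1) p = 'D_u ('D_(p.2) phi) p.1.
  apply: (etrans (esym (near_eq_derive _ (near_swap p.2)))).
  apply: (etrans ((dirv p.2).2 (vert u))).
  by rewrite derive_snd /= derive0 addr0.
have alg (x y : 'rV[R]_n) : y = x -> x + y = 2 *: x.
  by move=> ->; rewrite scalerDl scale1r.
exact: alg E.
Qed.

(** * Transformation laws of the spray coefficients, Gamma and nabla *)

Section Spray.
Context (S : tfield M).
Hypothesis tS : is_tfield S.
Hypothesis S1 : forall c p, slit c p -> (S c p).1 = p.2.
Local Notation f c := (fun q : V => (S c q).2).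

Lemma spray_trans p : slit_overlap a b p ->
  f b (T p) = 'D_(f a p) phi p.1 + 'D_(p.2) ('D_(p.2) phi) p.1.
Proof.
move=> sp; have [op _] := sp.
rewrite (tS.2 _ _ _ sp) (derive_tchart_trans op).2 /=.
by rewrite (S1 (slit_overlap_slit sp)).
Qed.

(** The transformation law of -2 Gamma. The Hessian term of [spray_trans] is quadratic in the
    velocity, whence the factor 2. *)
Lemma derive_spray_trans p u : slit_overlap a b p ->
  'D_(vert ('D_u phi p.1)) (f b) (T p)
    = 'D_('D_(vert u) (f a) p) phi p.1 + 2 *: 'D_u ('D_(p.2) phi) p.1.
Proof.
move=> sp; have [op _] := sp.
have sf c : smooth_on (slit c) (f c) by apply: smooth_comp_snd (tS.1 c); exact: open_slit.
have dfa := smooth_differentiable (sf a) (slit_overlap_slit sp).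
have dfb := smooth_differentiable (sf b) (slit_tchart_trans sp).
rewrite -(derive_tchart_trans_vert u op).
apply: (etrans (esym (derive_comp (vert u) (derive_tchart_trans op).1 dfb))).
have [d1 D1] := derive_along_fst (@smooth_chart_trans a b) op dfa.
have [d2 D2] := derive_hessian u op.
apply: (etrans (derive_ext (@open_slit_overlap a b) _ spray_trans sp)).
apply: (etrans (derive_add (vert u) d1 d2)).
apply: (congr2 (fun x y => x + y)); last exact: D2.
apply: (etrans (D1 (vert u))).
by apply: (etrans (congr1 (fun x => _ + x) (derive0 _ _))); exact: addr0.
Qed.

(** The Hessian enters once through the derivative of the components of [X], and once more through
    Gamma with factor -1/2 times 2; by its symmetry the two contributions cancel. *)
Lemma nabla_trans (X : along M) p : is_along X -> slit_overlap a b p ->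
  nabla S X b (T p) = 'D_(nabla S X a p) phi p.1.
Proof.
move=> aX sp; have [op _] := sp.
have sa := slit_overlap_slit sp; have sb := slit_tchart_trans sp.
have sf c : smooth_on (slit c) (f c) by apply: smooth_comp_snd (tS.1 c); exact: open_slit.
have dphi := smooth_differentiable (@smooth_chart_trans a b) op.
rewrite (nablaE (smooth_differentiable (sf b) sb) (smooth_differentiable (aX.1 b) sb)).
rewrite (nablaE (smooth_differentiable (sf a) sa) (smooth_differentiable (aX.1 a) sa)).
have E1 := derive_along_trans (S a p) aX sp.
rewrite -(tS.2 _ _ _ sp) (S1 sa) in E1.
have E2 := derive_spray_trans (X a p) sp.
rewrite -(aX.2 _ _ _ sp) in E2.
have E3 := smooth_derive_swap (X a p) p.2 cW (@open_overlap a b) (@smooth_chart_trans a b) op.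
have lin := linear_derive dphi.
set Y := 'D_(S a p) (X a) p in E1 *; set Z := 'D_(vert (X a p)) (f a) p in E2 *.
have E4 : 'D_(Y - 2^-1 *: Z) phi p.1 = 'D_Y phi p.1 - 2^-1 *: 'D_Z phi p.1.
  have -> : Y - 2^-1 *: Z = (- 2^-1) *: Z + Y by rewrite scaleNr addrC.
  apply: (etrans (lin _ _ _)).
  have alg2 (x y : 'rV[R]_n) : (- 2^-1) *: x + y = y - 2^-1 *: x by rewrite scaleNr addrC.
  exact: alg2.
have alg (x y z t k l m : 'rV[R]_n) : x = z + t -> y = l + 2 *: m -> m = t -> k = z - 2^-1 *: l ->
  x - 2^-1 *: y = k.
  by move=> -> -> -> ->; apply/rowP => i; rewrite !mxE; field.
exact: alg E1 E2 E3 E4.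
Qed.

End Spray.
End Overlap.

Lemma is_along_nabla (S : tfield M) (X : along M) : is_tfield S ->
  (forall c p, slit c p -> (S c p).1 = p.2) -> is_along X -> is_along (nabla S X).
Proof.
move=> tS S1 aX; split=> [a|a b p sp]; last exact: nabla_trans.
have oU := @open_slit R n M a.
have sf : smooth_on (slit a) (fun q => (S a q).2) by exact: smooth_comp_snd (tS.1 a).
have E q : slit a q -> 'D_(S a q) (X a) q - 2^-1 *: 'D_(vert (X a q)) (fun q => (S a q).2) q
   = nabla S X a q.
  move=> sq; symmetry; apply: nablaE; first exact: smooth_differentiable sf sq.
  exact: smooth_differentiable (aX.1 a) sq.
apply: (smooth_ext oU E).
have s1 := smooth_dir cV oU (aX.1 a) (tS.1 a).
have s2 := smooth_dir cV oU sf (smooth_vert oU (aX.1 a)).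
exact: (smoothB oU s1 (smoothZc oU _ s2)).
Qed.

Definition euler_along (X : along M) : along M := fun a p => 'D_(vert p.2) (X a) p.

(** The Liouville direction is vertical, so the Hessian term of [derive_along_trans] vanishes, and
    the differential of [tchart_trans] carries it to the Liouville direction of the other chart. *)
Lemma is_along_euler (X : along M) : is_along X -> is_along (euler_along X).
Proof.
move=> aX; split=> [a|a b p sp].
  exact: (smooth_dir cV (@open_slit R n M a) (aX.1 a) (smooth_vert (@open_slit R n M a) (@smooth_snd R n _))).
have [op _] := sp.
have := derive_along_trans (vert p.2) aX sp.
by rewrite derive_tchart_trans_vert // /= derive0 addr0.
Qed.

Lemma is_along_addT (k : func M) (X : along M) : is_func k -> is_along X ->
  is_along (fun a p => X a p + k a p *: Tcan a p).
Proof.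
move=> fk aX; split=> [a|a b p sp].
  have oU := @open_slit R n M a.
  exact: (smoothD oU (aX.1 a) (smoothZ oU (fk.1 a) (@smooth_snd R n _))).
have [op _] := sp.
have dphi := smooth_differentiable (@smooth_chart_trans a b) op.
rewrite (fk.2 _ _ _ sp) (aX.2 _ _ _ sp) addrC [X a p + _]addrC.
by symmetry; exact: (linear_derive dphi).
Qed.

Lemma is_func_pairing (c : covec M) (X : along M) : is_covec c -> is_along X ->
  is_func (pairing c X).
Proof.
move=> cc aX; split=> [a|a b p sp]; last first.
  by rewrite /pairing -(cc.2 _ _ _ sp); apply: eq_bigr => k _; rewrite (aX.2 _ _ _ sp).
have oU := @open_slit R n M a.
have coord (F : V -> 'rV[R]_n) i k : Ck k (slit a) F -> Ck k (slit a) (fun q => F q 0 i : R).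
  move=> sF.
  have lin : linear (fun v : 'rV[R]_n => v 0 i : R) by move=> x u v; rewrite !mxE.
  pose L : {linear 'rV[R]_n -> R} :=
    HB.pack (fun v : 'rV[R]_n => v 0 i : R) (GRing.isLinear.Build _ _ _ _ _ lin).
  by apply: (@Ck_comp_linear _ _ _ _ _ _ L) => //; exact: coord_continuous.
move=> k.
have H i : Ck k (slit a) (fun p => c a p 0 i *: (X a p 0 i : R)).
  by apply: CkZ => //; apply: coord; [exact: cc.1 | exact: aX.1].
exact: (Ck_bigsum _ oU H).
Qed.

Lemma is_func_div (F G : func M) : is_func F -> is_func G -> nowhere_zero G ->
  is_func (fun a p => F a p / G a p).
Proof.
move=> fF fG G0; split=> [a k|a b p sp]; last by rewrite (fF.2 _ _ _ sp) (fG.2 _ _ _ sp).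
have oU := @open_slit R n M a.
apply: (CkZ (f := fun p => (G a p)^-1 : R)) => //; first exact: fF.1.
by apply: CkV => //; [exact: G0 | exact: fG.1].
Qed.

End ChangeOfCharts.

Lemma linear_fun0 {R : pzRingType} {V W : lmodType R} (F : V -> W) : linear F -> F 0 = 0.
Proof.
by move=> lF; have := lF (-1) 0 0; rewrite scaler0 addr0 scaleN1r addNr.
Qed.

Lemma linear_funZ {R : pzRingType} {V W : lmodType R} (F : V -> W) a u :
  linear F -> F (a *: u) = a *: F u.
Proof.
by move=> lF; have := lF a u 0; rewrite (linear_fun0 lF) !addr0.
Qed.

Lemma linear_funB {R : pzRingType} {V W : lmodType R} (F : V -> W) u v :
  linear F -> F (u - v) = F u - F v.
Proof.
by move=> lF; have := lF (-1) v u; rewrite !scaleN1r ![- _ + _]addrC.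
Qed.

(** * The bracket *)

Section BracketInChart.
Context {R : realType} {n : nat}.
Local Notation V := (tcoord R n).
Local Notation vert u := ((0, u) : V).
Local Notation cW := (@has_coordinates_rV R n).
Context (U : set V) (oU : open U).
Context (f : V -> 'rV[R]_n) (sf : smooth_on U f).
Hypothesis hf : forall q, U q -> 'D_(vert q.2) f q = 2 *: f q.

(* The endomorphism [nabla Phi], as [S(Phi) + Gamma Phi - Phi Gamma]. *)
Definition nabla_jac (p : V) (u : 'rV[R]_n) : 'rV[R]_n :=
  'D_((p.2, f p) : V) (jac f ^~ u) p - 2^-1 *: 'D_(vert (jac f p u)) f p
  + jac f p (2^-1 *: 'D_(vert u) f p).

Lemma derive_jac (X : V -> 'rV[R]_n) p : U p -> differentiable X p ->
  differentiable (fun q => jac f q (X q)) p /\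
  forall w, 'D_w (fun q => jac f q (X q)) p = jac f p ('D_w X p) + 'D_w (jac f ^~ (X p)) p.
Proof.
move=> Up dX; apply: differentiable_family dX; first exact: cW.
  by apply: filterS (open_nbhs_nbhs (conj oU Up)) => q Uq; exact (jac_linear oU sf Uq).
by move=> u; exact: smooth_differentiable (smooth_jac oU sf u) Up.
Qed.

(** The derivatives of [X] cancel, so nabla(Phi X) - Phi(nabla X) depends on [X] through [X p]
    alone. *)
Lemma nabla_jacE (X : V -> 'rV[R]_n) p : U p -> differentiable X p ->
  'D_((p.2, f p) : V) (fun q => jac f q (X q)) p - 2^-1 *: 'D_(vert (jac f p (X p))) f p
  - jac f p ('D_((p.2, f p) : V) X p - 2^-1 *: 'D_(vert (X p)) f p) = nabla_jac p (X p).
Proof.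
move=> Up dX; have [_ D1] := derive_jac Up dX.
have E1 := D1 ((p.2, f p) : V).
have E2 := linear_funB ('D_((p.2, f p) : V) X p) (2^-1 *: 'D_(vert (X p)) f p)
  (jac_linear oU sf Up).
have alg (x y z t k l m : 'rV[R]_n) : x = y + z -> t = y - k -> x - l - t = z - l + k.
  move=> -> ->; apply/rowP => i; rewrite !mxE; ring.
exact: (alg _ _ _ _ _ _ 0 E1 E2).
Qed.

Lemma nabla_jac_linear p : U p -> linear (nabla_jac p).
Proof.
move=> Up a u v.
have linf := linear_derive (smooth_differentiable sf Up).
have linj := jac_linear oU sf Up.
have dj w := smooth_differentiable (smooth_jac oU sf w) Up.
have E1 : 'D_((p.2, f p) : V) (jac f ^~ (a *: u + v)) p
  = a *: 'D_((p.2, f p) : V) (jac f ^~ u) p + 'D_((p.2, f p) : V) (jac f ^~ v) p.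
  apply: (etrans (derive_ext oU _ (fun q Uq => jac_linear oU sf Uq a u v) Up)).
  have saj := smooth_differentiable (smoothZc oU a (smooth_jac oU sf u)) Up.
  apply: (etrans (derive_add _ saj (dj v))).
  by apply: (congr1 (fun x => x + _)); exact: derive_scalec.
have E2 : 'D_(vert (jac f p (a *: u + v))) f p
  = a *: 'D_(vert (jac f p u)) f p + 'D_(vert (jac f p v)) f p.
  apply: (etrans (congr1 (fun x => 'D_(vert x) f p) (linj a u v))); rewrite vertP.
  exact: linf.
have E3 : jac f p (2^-1 *: 'D_(vert (a *: u + v)) f p)
  = a *: jac f p (2^-1 *: 'D_(vert u) f p) + jac f p (2^-1 *: 'D_(vert v) f p).
  have E : 2^-1 *: 'D_(vert (a *: u + v)) f p
      = a *: (2^-1 *: 'D_(vert u) f p) + 2^-1 *: 'D_(vert v) f p.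
    rewrite vertP; apply: (etrans (congr1 (fun x => 2^-1 *: x) (linf _ _ _))).
    by rewrite scalerDr !scalerA [2^-1 * a]mulrC.
  exact: (etrans (congr1 (jac f p) E) (linj _ _ _)).
have alg (x y z x1 y1 z1 x2 y2 z2 : 'rV[R]_n) : x = a *: x1 + x2 -> y = a *: y1 + y2 ->
  z = a *: z1 + z2 ->
  x - 2^-1 *: y + z = a *: (x1 - 2^-1 *: y1 + z1) + (x2 - 2^-1 *: y2 + z2).
  move=> -> -> ->; apply/rowP => i; rewrite !mxE; ring.
exact: alg E1 E2 E3.
Qed.

(** The identity Phi(T) = 0 is differentiated along the spray; the derivative [f p] of the velocity
    is offset by the Gamma term, which is nabla T = 0. *)
Lemma nabla_jac_T p : U p -> nabla_jac p p.2 = 0.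
Proof.
move=> Up.
have e0 := jac_T oU sf hf Up.
have [_ D1] := derive_jac Up (differentiable_snd p).
have E1 : 'D_((p.2, f p) : V) (fun q => jac f q q.2) p = 0.
  apply: (etrans (derive_ext oU (g := fun=> 0) _ _ Up)); last exact: derive_cst.
  by move=> q Uq; exact (jac_T oU sf hf Uq).
have E2 := D1 ((p.2, f p) : V); rewrite derive_snd /= in E2.
have E3 : 'D_(vert (jac f p p.2)) f p = 0.
  by apply: (etrans (congr1 (fun x => 'D_(vert x) f p) e0)); exact: derive0.
have E4 : jac f p (2^-1 *: 'D_(vert p.2) f p) = jac f p (f p).
  by apply: (congr1 (jac f p)); rewrite (hf Up) scalerA mulVf ?scale1r // pnatr_eq0.
have alg (x y z t k : 'rV[R]_n) : x = 0 -> x = y + z -> t = 0 -> k = y -> z - 2^-1 *: t + k = 0.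
  by move=> -> e -> ->; rewrite scaler0 subr0 addrC -e.
exact: alg E1 E2 E3 E4.
Qed.

Lemma bracket_jac_T p (k : R) : U p ->
  nabla_jac p (jac f p (k *: p.2)) - jac f p (nabla_jac p (k *: p.2)) = 0.
Proof.
move=> Up.
have linN := nabla_jac_linear Up; have linJ := jac_linear oU sf Up.
have J0 : jac f p (k *: p.2) = 0.
  by rewrite (linear_funZ _ _ linJ) (jac_T oU sf hf Up) scaler0.
have N0 : nabla_jac p (k *: p.2) = 0.
  by rewrite (linear_funZ _ _ linN) (nabla_jac_T Up) scaler0.
by rewrite J0 N0 (linear_fun0 linN) (linear_fun0 linJ) subr0.
Qed.

Section EigenDirection.
Context (X : V -> 'rV[R]_n) (mu e : V -> R) (p : V).
Hypotheses (Up : U p) (dX : differentiable X p).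
Hypotheses (dmu : differentiable mu p) (de : differentiable e p).
Hypothesis JX : forall q, U q -> jac f q (X q) = mu q *: X q + e q *: q.2.

Let derive_JX w : 'D_w (fun q => jac f q (X q)) p
  = 'D_w mu p *: X p + mu p *: 'D_w X p + ('D_w e p *: p.2 + e p *: w.2).
Proof.
apply: (etrans (derive_ext oU w JX Up)).
have dy := differentiable_snd p.
apply: (etrans (derive_add w (differentiable_scale dmu dX) (differentiable_scale de dy))).
rewrite (derive_scale w dmu dX); apply: (congr1 (fun x => _ + x)).
by apply: (etrans (derive_scale w de dy)); rewrite derive_snd.
Qed.

(** [eps] stands for e(Delta X). Differentiating [JX] along the Liouville direction, with [jac] of
    degree 2, leaves a linear relation between [X p] and [p.2]. *)
Lemma euler_eigen (eps : R) :
  jac f p ('D_(vert p.2) X p) = mu p *: 'D_(vert p.2) X p + eps *: p.2 ->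
  ('D_(vert p.2) mu p - 2 * mu p) *: X p + ('D_(vert p.2) e p - eps - e p) *: p.2 = 0.
Proof.
move=> E1.
have E2 := derive_JX (vert p.2).
have [_ D1] := derive_jac Up dX.
have E3 := D1 (vert p.2).
have E4 : 'D_(vert p.2) (jac f ^~ (X p)) p = 2 *: (mu p *: X p + e p *: p.2).
  by rewrite -(JX Up); exact: (euler_jac oU sf hf (X p) Up).
have scal (u t v r s m d : R) :
  r * u + m * t + (s * v + d * v) = m * t + eps * v + 2 * (m * u + d * v) ->
  (r - 2 * m) * u + (s - eps - d) * v = 0.
  move=> h.
  have -> : (r - 2 * m) * u + (s - eps - d) * v
    = r * u + m * t + (s * v + d * v) - (m * t + eps * v + 2 * (m * u + d * v)) by ring.
  by rewrite h subrr.
have alg (x y z t u v : 'rV[R]_n) (r s m d : R) :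
  y = m *: t + eps *: v -> x = r *: u + m *: t + (s *: v + d *: v) -> x = y + z ->
  z = 2 *: (m *: u + d *: v) -> (r - 2 * m) *: u + (s - eps - d) *: v = 0.
  move=> -> -> h1 h2; move: h1; rewrite h2 => /rowP h.
  by apply/rowP => i; have := h i; rewrite !mxE; exact: scal.
exact: alg E1 E2 E3 E4.
Qed.

(** [Z] is nabla X and [eps] stands for e(Z). Since nabla T = 0, (nabla Phi) X equals S(mu) X +
    (S(e(X)) - eps) T. As Phi and nabla Phi both annihilate T, the multiples of X cancel in the
    commutator. *)
Lemma bracket_jac_eigen (eps : R) (Z := 'D_((p.2, f p) : V) X p - 2^-1 *: 'D_(vert (X p)) f p) :
  jac f p Z = mu p *: Z + eps *: p.2 ->
  nabla_jac p (jac f p (X p)) - jac f p (nabla_jac p (X p))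
  = (mu p * ('D_((p.2, f p) : V) e p - eps) - 'D_((p.2, f p) : V) mu p * e p) *: p.2.
Proof.
move=> EZ.
set s : V := (p.2, f p); set y := p.2.
have NE : nabla_jac p (X p) = 'D_s mu p *: X p + ('D_s e p - eps) *: y.
  apply: (etrans (esym (nabla_jacE Up dX))).
  have E1 := derive_JX s.
  have linf := linear_derive (smooth_differentiable sf Up).
  have E2 : 'D_(vert (jac f p (X p))) f p = mu p *: 'D_(vert (X p)) f p + (2 * e p) *: f p.
    apply: (etrans (congr1 (fun x => 'D_(vert x) f p) (JX Up))).
    rewrite vertP; apply: (etrans (linf _ _ _)); apply: (congr1 (fun x => _ + x)).
    have -> : vert (e p *: p.2) = e p *: vert p.2 by congr pair; rewrite /= scaler0.
    apply: (etrans (derive_scalev _ _ (smooth_differentiable sf Up))).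
    by rewrite (hf Up) scalerA mulrC.
  have alg (x x1 x2 x3 x4 u v g : 'rV[R]_n) (r s' m d : R) :
    x = r *: u + m *: x1 + (s' *: v + d *: g) -> x2 = m *: x3 + (2 * d) *: g ->
    x4 = m *: (x1 - 2^-1 *: x3) + eps *: v ->
    x - 2^-1 *: x2 - x4 = r *: u + (s' - eps) *: v.
    by move=> -> -> ->; apply/rowP => i; rewrite !mxE; field.
  exact: alg E1 E2 EZ.
have NT := nabla_jac_T Up.
have JT := jac_T oU sf hf Up.
have linN := nabla_jac_linear Up.
have linJ := jac_linear oU sf Up.
have NJ : nabla_jac p (jac f p (X p)) = mu p *: nabla_jac p (X p).
  apply: (etrans (congr1 (nabla_jac p) (JX Up))); apply: (etrans (linN _ _ _)).
  by rewrite (linear_funZ _ _ linN) NT scaler0 addr0.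
have JN : jac f p (nabla_jac p (X p)) = 'D_s mu p *: jac f p (X p).
  apply: (etrans (congr1 (jac f p) NE)); apply: (etrans (linJ _ _ _)).
  by rewrite (linear_funZ _ _ linJ) JT scaler0 addr0.
rewrite NJ JN NE (JX Up).
by apply/rowP => i; rewrite !mxE; ring.
Qed.

End EigenDirection.
End BracketInChart.

(** * From the bracket of operators on fields to the bracket at a point *)

Section BracketBridge.
Context {R : realType} {n : nat} (M : smooth_manifold R n) (S : tfield M) (a : chart M).
Local Notation V := (tcoord R n).
Local Notation vert u := ((0, u) : V).
Local Notation f := (fun q : V => (S a q).2).
Hypothesis S1 : forall q, slit a q -> (S a q).1 = q.2.
Hypothesis sS : smooth_on (slit a) (S a).

Let oU : open (slit a).
Proof. exact: open_slit. Qed.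

Let sf : smooth_on (slit a) f.
Proof. exact: smooth_comp_snd sS. Qed.

Lemma differentiable_Jacobi (Z : along M) p : slit a p -> differentiable (Z a) p ->
  differentiable (Jacobi S Z a) p.
Proof.
move=> sp dZ; apply: near_differentiable (derive_jac oU sf sp dZ).1.
apply: filterS (open_nbhs_nbhs (conj oU sp)) => q sq.
exact: (esym (JacobiE S1 sS Z sq)).
Qed.

Lemma nabla_endo_JacobiE (Z : along M) p : slit a p -> differentiable (Z a) p ->
  nabla_endo S (Jacobi S) Z a p = nabla_jac f p (Z a p).
Proof.
move=> sp dZ; have df := smooth_differentiable sf sp.
have dJ := differentiable_Jacobi sp dZ.
apply: (etrans _ (nabla_jacE oU sf sp dZ)).
apply: (congr2 (fun x y => x - y)).
  apply: (etrans (nablaE df dJ)); apply: (congr2 (fun x y => x - y)).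
    rewrite (sprayE S1 sp); apply: (derive_ext oU _ _ sp) => q sq.
    exact (JacobiE S1 sS Z sq).
  apply: (congr1 (fun x => 2^-1 *: 'D_(vert x) f p)); exact (JacobiE S1 sS Z sp).
apply: (etrans (JacobiE S1 sS _ sp)); apply: (congr1 (jac f p)).
by apply: (etrans (nablaE df dZ)); rewrite (sprayE S1 sp).
Qed.

Lemma bracket_JacobiE (Y : along M) p : slit a p -> differentiable (Y a) p ->
  bracket (nabla_endo S (Jacobi S)) (Jacobi S) Y a p
  = nabla_jac f p (jac f p (Y a p)) - jac f p (nabla_jac f p (Y a p)).
Proof.
move=> sp dY; apply: (congr2 (fun x y => x - y)).
  apply: (etrans (nabla_endo_JacobiE sp (differentiable_Jacobi sp dY))).
  apply: (congr1 (nabla_jac f p)); exact (JacobiE S1 sS Y sp).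
apply: (etrans (JacobiE S1 sS _ sp)); apply: (congr1 (jac f p)).
exact: nabla_endo_JacobiE sp dY.
Qed.

End BracketBridge.

Section GlobalFields.
Context {R : realType} {n : nat} (M : smooth_manifold R n).
Local Notation V := (tcoord R n).
Local Notation vert u := ((0, u) : V).

Lemma is_along_Tcan : is_along (@Tcan R n M).
Proof. by split=> [a|a b p _] //; exact: smooth_snd. Qed.

(** Phi(T) = 0 gives (lambda + c(T)) T = 0, and T does not vanish on the slit. *)
Lemma isotropic_T (S : tfield M) (lam : func M) (c : covec M) :
  is_spray S -> isotropic_with S lam c ->
  forall a p, slit a p -> pairing c (@Tcan R n M) a p = - lam a p.
Proof.
move=> [tS S1 Sh] iso a p sp.
have oU : open (slit a) by exact: open_slit.
have sf : smooth_on (slit a) (fun q => (S a q).2) by exact: smooth_comp_snd (tS.1 a).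
have hf q : slit a q -> 'D_(vert q.2) (fun q => (S a q).2) q = 2 *: (S a q).2.
  by move=> sq; apply: (euler_of_bracket (tS.1 a) sq); exact: Sh.
have E2 := etrans (esym (JacobiE (S1 a) (tS.1 a) (@Tcan R n M) sp)) (iso _ is_along_Tcan a p sp).
have E3 := jac_T oU sf hf sp.
have : (lam a p + pairing c (@Tcan R n M) a p) *: p.2 = 0.
  by rewrite scalerDl -[RHS]E3; exact: esym E2.
move/eqP; rewrite scaler_eq0 (negbTE sp.2) orbF addrC => /eqP e.
by apply/eqP; rewrite -subr_eq0 opprK e.
Qed.

Lemma smooth_bpro (U : set V) (f X : V -> 'rV[R]_n) (P : V -> R) : open U ->
  smooth_on U f -> smooth_on U P -> smooth_on U X ->
  smooth_on U (fun q => bpro f P q (X q)).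
Proof.
move=> oU sf sP sX.
have cV := @has_coordinates_tcoord R n.
have sv := smooth_vert oU sX.
have sh := smooth_pair oU sX (smoothZc oU 2^-1 (smooth_dir cV oU sf sv)).
have s1 := smoothZc oU 3 (smooth_dir cV oU sP sh).
have s2 := smoothZ oU sP (smooth_dir cV oU sP sv).
have s3 := smooth_dir cV oU (smooth_dir cV oU sP (smooth_spray oU sf)) sv.
exact (smoothB oU (smoothB oU s1 s2) s3).
Qed.

End GlobalFields.

Theorem proposition5 (R : realType) (n : nat) (M : smooth_manifold R n)
    (S : tfield M) (lam : func M) (c : covec M) (P : func M) :
  let a := proj_a S P in
  let b := proj_b S P in
  let S' := proj_change S P in
  is_spray S ->
  is_func lam -> is_covec c ->
  isotropic_with S lam c ->
  nowhere_zero lam ->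
  is_func P -> homogeneous1 P ->
  nowhere_zero (func_add lam a) ->
  (forall X : along M, eigenfield (Jacobi S) lam X ->
     forall (i : chart M) (p : tcoord R n), slit i p ->
       nabla_form S (add_form (pairing c) b) X i p
       + (P i p - lie_der S (func_add lam a) i p / func_add lam a i p) * b X i p
       + func_add lam a i p * dV P X i p = 0) ->
  forall Y : along M, is_along Y ->
    forall (i : chart M) (p : tcoord R n), slit i p ->
      bracket (nabla_endo S' (Jacobi S')) (Jacobi S') Y i p = 0.
Proof.
move=> a b S' spS flam cc iso lam0 fP hP mu0 hyp Y aY i p sp.
have [tS S1 Sh] := spS.
have oU : open (slit i) by exact: open_slit.
have S1i := S1 i; have sS := tS.1 i; have sPi := fP.1 i.
have S1i' : forall q, slit i q -> (S' i q).1 = q.2 by move=> q sq; exact: proj_change1.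
have sS' : smooth_on (slit i) (S' i) by exact: smooth_proj_change.
pose f q := (S i q).2.
have sf : smooth_on (slit i) f by exact: smooth_comp_snd sS.
have hf q : slit i q -> 'D_((0, q.2) : tcoord R n) f q = 2 *: f q.
  by move=> sq; apply: (euler_of_bracket sS sq); exact: Sh.
have hPi q : slit i q -> 'D_((0, q.2) : tcoord R n) (P i) q = P i q.
  by move=> sq; exact: euler_of_homogeneous1.
pose f' := pchange f (P i).
have sf' : smooth_on (slit i) f' by exact: smooth_pchange.
have hf' q : slit i q -> 'D_((0, q.2) : tcoord R n) f' q = 2 *: f' q.
  exact: euler_pchange.
have aT := is_along_Tcan M.
pose mu := func_add lam a.
(* The form e = c + b as a function of vectors at a point, so that it also applies to nabla' X,
   which will be computed at [p] only. *)
pose eps (q : tcoord R n) (u : 'rV[R]_n) : R :=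
  (\sum_(k < n) c i q 0 k * u 0 k) + bpro f (P i) q u.
have eps_lin x u v : eps p (x *: u + v) = x * eps p u + eps p v.
  rewrite /eps.
  have -> : \sum_(k < n) c i p 0 k * (x *: u + v) 0 k
    = x * (\sum_(k < n) c i p 0 k * u 0 k) + \sum_(k < n) c i p 0 k * v 0 k.
    by rewrite mulr_sumr -big_split /=; apply: eq_bigr => k _; rewrite !mxE; ring.
  have E : bpro f (P i) p (x *: u + v) = x * bpro f (P i) p u + bpro f (P i) p v.
    exact (bpro_linear oU sf sPi sp x u v).
  have alg (x1 x2 x3 x4 : R) : x * x1 + x2 + (x * x3 + x4) = x * (x1 + x3) + (x2 + x4) by ring.
  exact: (etrans (congr1 (fun y => _ + y) E) (alg _ _ _ _)).
have epsE (Z : along M) q : slit i q ->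
    add_form (pairing c) b Z i q = eps q (Z i q).
  by move=> sq; rewrite /add_form /func_add /b (proj_bE S1i sS Z sPi sq).
have JE (Z : along M) q : is_along Z -> slit i q ->
    jac f' q (Z i q) = mu i q *: Z i q + eps q (Z i q) *: q.2.
  move=> aZ sq.
  have E1 := jac_pchange oU sf hf sPi hPi (Z i q) sq.
  have E2 := etrans (esym (JacobiE S1i sS Z sq)) (iso Z aZ i q sq).
  have E3 : mu i q = lam i q + (P i q ^+ 2 - 'D_((q.2, f q) : tcoord R n) (P i) q).
    by rewrite /mu /func_add /a /proj_a /lie_der -(sprayE S1i sq).
  have alg (x y z t : 'rV[R]_n) (l k g r m d : R) : x = y + k *: z + r *: t ->
     y = l *: z + g *: t -> m = l + k -> d = g + r -> x = m *: z + d *: t.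
    by move=> -> -> -> ->; apply/rowP => j; rewrite !mxE; ring.
  exact: (alg _ _ _ _ _ _ _ _ _ _ E1 E2 E3 erefl).
have epsT : eps p p.2 = - mu i p.
  have E2 := JE _ _ aT sp; have E3 := jac_T oU sf' hf' sp.
  have : (mu i p + eps p p.2) *: p.2 = 0.
    by rewrite scalerDl -[RHS]E3; exact: esym E2.
  move/eqP; rewrite scaler_eq0 (negbTE sp.2) orbF addrC => /eqP e.
  by apply/eqP; rewrite -subr_eq0 opprK e.
(* As c(T) = -lambda, adding (c(Y) / lambda) T to Y makes c vanish, so the new field lies in
   D_lambda. *)
pose k : func M := fun a p => pairing c Y a p / lam a p.
have fk : is_func k by apply: is_func_div => //; exact: is_func_pairing.
pose X : along M := fun a p => Y a p + k a p *: Tcan a p.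
have aX : is_along X := is_along_addT fk aY.
have cX j q : slit j q -> pairing c X j q = 0.
  move=> sq; have E := isotropic_T spS iso sq.
  have -> : pairing c X j q = pairing c Y j q + k j q * pairing c (@Tcan R n M) j q.
    by rewrite /pairing mulr_sumr -big_split /=; apply: eq_bigr => l _; rewrite !mxE; ring.
  by rewrite E mulrN /k divfK ?subrr //; exact: lam0.
have eigX : eigenfield (Jacobi S) lam X.
  split=> // j q sq; rewrite iso // cX // scale0r addr0 //.
have linN := nabla_jac_linear oU sf' sp.
have linJ := jac_linear oU sf' sp.
have dX := smooth_differentiable (aX.1 i) sp.
have dY := smooth_differentiable (aY.1 i) sp.
apply: (etrans (bracket_JacobiE S1i' sS' sp dY)).
pose B u := nabla_jac f' p (jac f' p u) - jac f' p (nabla_jac f' p u).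
change (B (Y i p) = 0).
have linB : linear B.
  move=> x u v; rewrite /B linJ linN linN linJ.
  have alg (x1 x2 x3 x4 : 'rV[R]_n) : x *: x1 + x2 - (x *: x3 + x4) = x *: (x1 - x3) + (x2 - x4).
    by apply/rowP => j; rewrite !mxE; ring.
  exact: alg.
have BT t : B (t *: p.2) = 0 by exact: (bracket_jac_T oU sf' hf' t sp).
suff BX : B (X i p) = 0.
  by have := linear_funB (X i p) (k i p *: p.2) linB; rewrite BX BT subr0 addrK.
(* Otherwise [X i p] and [p.2] are independent, and the relation of [euler_eigen] splits into two
   scalar equations. *)
have [[t Xt]|npar] := pselect (exists t, X i p = t *: p.2); first by rewrite Xt.
pose e (q : tcoord R n) := add_form (pairing c) b X i q.
have JX q : slit i q -> jac f' q (X i q) = mu i q *: X i q + e q *: q.2.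
  by move=> sq; rewrite /e epsE //; exact: JE.
have se : smooth_on (slit i) e.
  apply: (smooth_ext oU (f := fun q => pairing c X i q + bpro f (P i) q (X i q))).
    by move=> q sq; rewrite /e epsE.
  exact: (smoothD oU ((is_func_pairing cc aX).1 i) (smooth_bpro oU sf sPi (aX.1 i))).
have smu : smooth_on (slit i) (mu i).
  have sSP := smooth_dir (@has_coordinates_tcoord R n) oU sPi sS.
  exact (smoothD oU (flam.1 i) (smoothB oU (smoothZ oU sPi sPi) sSP)).
have de := smooth_differentiable se sp; have dmu := smooth_differentiable smu sp.
have [Emu Ee] : 'D_((0, p.2) : tcoord R n) (mu i) p = 2 * mu i p /\
    'D_((0, p.2) : tcoord R n) e p = eps p ('D_((0, p.2) : tcoord R n) (X i) p) + e p.
  have E := euler_eigen oU sf' hf' sp dX dmu de JX (JE _ _ (is_along_euler aX) sp).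
  have lindep (r s : R) : r *: X i p + s *: p.2 = 0 -> r = 0 /\ s = 0.
    move=> rs; have r0 : r = 0.
      apply/eqP; apply/negPn/negP => rn0; apply: npar; exists (- (r^-1 * s)).
      rewrite scaleNr -scalerA; apply: (scalerI rn0).
      by rewrite scalerN scalerKV //; apply/eqP; rewrite -addr_eq0 rs.
    split=> //; move: rs; rewrite r0 scale0r add0r => /eqP.
    by rewrite scaler_eq0 (negbTE sp.2) orbF => /eqP.
  have [E1 E2] := lindep _ _ E.
  have alg1 (x y : R) : x - y = 0 -> x = y by exact: subr0_eq.
  have alg2 (x y z : R) : x - y - z = 0 -> x = y + z.
    by rewrite -addrA -opprD; exact: subr0_eq.
  by split; [exact: alg1 E1 | exact: alg2 E2].
(* The value e(Delta X) stays undetermined; it cancels at the end. *)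
set eD := eps p _ in Ee.
pose DX := euler_along X i p.
pose NX := nabla S X i p.
pose v := 'D_((0, X i p) : tcoord R n) (P i) p.
pose s' : tcoord R n := (p.2, f' p).
have s'E : s' = S i p - (2 * P i p) *: ((0, p.2) : tcoord R n).
  by rewrite (sprayE S1i sp); congr pair; rewrite /= ?scaler0 ?subr0.
have dirS (W : normedModType R) (g : tcoord R n -> W) : differentiable g p ->
  'D_s' g p = 'D_(S i p) g p - (2 * P i p) *: 'D_((0, p.2) : tcoord R n) g p.
  move=> dg; rewrite s'E.
  apply: (etrans (derive_addv _ _ dg)); apply: (congr2 (fun x y => x + y) erefl).
  by apply: (etrans (derive_oppv _ dg)); apply: (congr1 (fun x => - x)); exact: derive_scalev.
pose Z := 'D_s' (X i) p - 2^-1 *: 'D_((0, X i p) : tcoord R n) f' p.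
(* [Z] is nabla' X and [v] is X^V(P); the sum is nested in the shape that [eps_lin] and [GP] take
   apart. *)
have ZE : Z = v *: p.2 + (P i p *: X i p + (- (2 * P i p) *: DX + NX)).
  have E1 := dirS _ _ dX.
  have E2 := derive_pchange oU sf sPi ((0, X i p) : tcoord R n) sp.
  have E3 := nablaE (S := S) (X := X) (smooth_differentiable sf sp) dX.
  have alg (x y z t l m g h : 'rV[R]_n) (r w : R) :
     x = y - (2 * r) *: z -> t = l - (2 * w) *: m - (2 * r) *: g -> h = y - 2^-1 *: l ->
     x - 2^-1 *: t = w *: m + (r *: g + (- (2 * r) *: z + h)).
    by move=> -> -> ->; apply/rowP => j; rewrite !mxE; field.
  exact: alg E1 E2 E3.
(* [G] holds for the values at [p] of the global fields T, X, Delta X and nabla X, and [GP] closes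
   it under linear combinations; hence it holds for [Z]. *)
pose G u := jac f' p u = mu i p *: u + eps p u *: p.2.
have GP x u w : G u -> G w -> G (x *: u + w).
  move=> Gu Gw; apply: (etrans (linJ _ _ _)).
  have alg (y1 y2 y : 'rV[R]_n) (m r1 r2 r : R) : r = x * r1 + r2 ->
    x *: (m *: y1 + r1 *: y) + (m *: y2 + r2 *: y) = m *: (x *: y1 + y2) + r *: y.
    by move=> ->; apply/rowP => j; rewrite !mxE; ring.
  apply: (etrans (congr2 (fun y1 y2 => x *: y1 + y2) Gu Gw)).
  exact: alg (eps_lin x u w).
have GZ : G Z.
  rewrite ZE; apply: (GP _ _ _ (JE _ _ aT sp)); apply: (GP _ _ _ (JE _ _ aX sp)).
  apply: (GP _ _ _ (JE _ _ (is_along_euler aX) sp)).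
  exact: (JE _ _ (is_along_nabla tS S1 aX) sp).
have epsZ : eps p Z = v * - mu i p + (P i p * e p + (- (2 * P i p) * eD + eps p NX)).
  by rewrite ZE !eps_lin epsT /e epsE.
apply: (etrans (bracket_jac_eigen oU sf' hf' sp dX dmu de JX GZ)).
have H := hyp X eigX i p sp.
(* Since c(X) = 0, the b(X) of the hypothesis is e(X). *)
have He : b X i p = e p by rewrite /e /add_form /func_add cX // add0r.
have Hn : nabla_form S (add_form (pairing c) b) X i p = 'D_(S i p) e p - eps p NX.
  by rewrite /nabla_form epsE.
rewrite He Hn in H.
have mun0 : mu i p != 0 by exact: mu0.
have E1 := dirS _ _ dmu; have E2 := dirS _ _ de.
(* The multiples of P e(X), up to the common factor mu: 4 from S'(mu), as mu has degree 2, then -2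
   from S'(e(X)) and -1 from e(nabla' X). They add up to the single P of the hypothesis, and the
   terms in P e(Delta X) cancel. *)
have alg (x y z t l m d r w g h o dm : R) : m != 0 ->
  z = 2 * m -> l = o + d ->
  x = dm - (2 * r) * z -> y = t - (2 * r) * l ->
  g = w * - m + (r * d + (- (2 * r) * o + h)) ->
  t - h + (r - dm / m) * d + m * w = 0 -> m * (y - g) - x * d = 0.
  move=> m0 -> -> -> -> -> e0.
  have <- : m * (t - h + (r - dm / m) * d + m * w) = 0 by rewrite e0 mulr0.
  by field.
have alg2 (x : R) (y : 'rV[R]_n) : x = 0 -> x *: y = 0 by move=> ->; rewrite scale0r.
apply: alg2; exact: (alg _ _ _ _ _ _ _ _ _ _ _ _ _ mun0 Emu Ee E1 E2 epsZ H).
Qed.
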